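(* The deterministic query complexity of the three-dimensional \textsc{Tarski} problem on lattices of width $n$ is $\Theta(\log^2 n)$.
   Context: For positive integers $n_1,\dots,n_k$, the lattice $L = L(n_1,\dots,n_k)$ is the set of all $x \in \mathbb{N}^k$ with $1 \le x_i \le n_i$ for all $i$, ordered by $x \preceq y$ iff $x_i \le y_i$ for all $i$; its width is $n = \max_i n_i$. The \textsc{Tarski} problem: given oracle (query) access to a function $f : L \to L$, find either (T1) a point $x \in L$ with $f(x) = x$, or (T2) two points $x, y \in L$ with $x \preceq y$ and $f(x) \not\preceq f(y)$. A query is one evaluation of $f$; the query complexity of an algorithm is the maximum number of queries it makes, and the deterministic query complexity of the problem is the minimum of this over deterministic algorithms. Three-dimensional means $k = 3$. *)

(* Defs.v *)
From HB Require Import structures.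
From mathcomp Require Import all_boot all_order all_algebra.
From mathcomp Require Import all_classical all_reals all_analysis.

Set Implicit Arguments.
Unset Strict Implicit.
Unset Printing Implicit Defensive.

Section Lattice.
Variables (k : nat) (m : 'I_k -> nat).

Definition width : nat := \max_(i < k) m i.

(* Storing coordinates in 'I_(width.+1) loses nothing, since x i <= m i <= width,
   and makes the lattice a finType. *)
Definition lattice : Type :=
  {x : {ffun 'I_k -> 'I_width.+1} | [forall i, 1 <= x i <= m i]}.

HB.instance Definition _ := SubFinite.on lattice.

Definition coord (x : lattice) (i : 'I_k) : nat := val x i.

Definition lattice_le (x y : lattice) : bool :=
  [forall i, coord x i <= coord y i].

End Lattice.

(* A deterministic algorithm with oracle access to a function X -> Y is an
   adaptive decision tree: it either outputs an answer, or queries a point and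
   continues according to the value returned. *)
Inductive algorithm (X Y A : Type) : Type :=
  | Output of A
  | Query of X & (Y -> algorithm X Y A).

Arguments Output {X Y A}.
Arguments Query {X Y A}.

Fixpoint run X Y A (t : algorithm X Y A) (f : X -> Y) : A :=
  match t with
  | Output a => a
  | Query x next => run (next (f x)) f
  end.

Fixpoint num_queries X Y A (t : algorithm X Y A) (f : X -> Y) : nat :=
  match t with
  | Output _ => 0
  | Query x next => (num_queries (next (f x)) f).+1
  end.

Section Tarski.
Variables (k : nat) (m : 'I_k -> nat).
Local Notation L := (lattice m).

Inductive answer : Type :=
  | FixedPoint of L
  | Violation of L & L.

Definition is_solution (f : L -> L) (a : answer) : Prop :=
  match a with
  | FixedPoint x => f x = x
  | Violation x y => lattice_le x y /\ ~ lattice_le (f x) (f y)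
  end.

Definition tarski_algorithm : Type := algorithm L L answer.

Definition solves_tarski (t : tarski_algorithm) : Prop :=
  forall f : L -> L, is_solution f (run t f).

Definition worst_case_queries (t : tarski_algorithm) : nat :=
  \max_(f : {ffun L -> L}) num_queries t f.

Definition is_query_complexity (q : nat) : Prop :=
  (exists2 t, solves_tarski t & worst_case_queries t = q) /\
  (forall t, solves_tarski t -> q <= worst_case_queries t).

(* The default value 0 is never used when all sides are positive, see
   [query_complexityP] below. *)
Definition query_complexity : nat := xget 0 is_query_complexity.

End Tarski.

(* The worst case over all k-dimensional lattices L(m_1, ..., m_k) of width n;
   the sides of such a lattice are at most n. *)
Definition tarski_query_complexity (k n : nat) : nat :=
  \max_(m : {ffun 'I_k -> 'I_n.+1} |
        [forall i, 0 < m i] && (width (fun i => m i) == n))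
    query_complexity (fun i => m i).

Section WellDefined.
Variables (k : nat) (m : 'I_k -> nat).
Hypothesis m_gt0 : forall i, 0 < m i.
Local Notation L := (lattice m).

Let ones : {ffun 'I_k -> 'I_(width m).+1} := [ffun _ => inord 1].

Let onesP : [forall i, 1 <= ones i <= m i].
Proof.
apply/forallP => i; rewrite ffunE inordK ?m_gt0 // ltnS.
exact: leq_trans (m_gt0 i) (leq_bigmax i).
Qed.

Let bottom : L := Sub ones onesP.

Let bottomP (x : L) : lattice_le bottom x.
Proof.
apply/forallP => i; rewrite /coord /= ffunE inordK.
  by have /forallP/(_ i)/andP[] := valP x.
by rewrite ltnS; exact: leq_trans (m_gt0 i) (leq_bigmax i).
Qed.

Let exists_solution (f : L -> L) : exists a, is_solution f a.
Proof.
have [viol|mono] := pselect (exists x y, lattice_le x y /\ ~ lattice_le (f x) (f y)).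
  by case: viol => x [y xy]; exists (Violation x y).
pose S (x : L) := \sum_i coord x i.
have [x xfx xmax] := @arg_maxnP _ bottom (fun x => lattice_le x (f x)) S (bottomP _).
exists (FixedPoint x) => /=.
have ffx : lattice_le (f x) (f (f x)).
  by apply: contrapT => h; apply: mono; exists x, (f x).
have fle i : coord x i <= coord (f x) i by move/forallP: xfx.
have Seq : \sum_i (coord (f x) i - coord x i) = 0.
  by apply/eqP; rewrite sumnB // subn_eq0; exact: xmax.
apply/val_inj/ffunP => i; apply/val_inj/eqP; rewrite /= eqn_leq.
rewrite [X in _ && X](fle i) andbT -subn_eq0.
by move/eqP: Seq; rewrite sum_nat_eq0 => /forallP/(_ i).
Qed.

Let solution_of (f : L -> L) : answer m := projT1 (cid (exists_solution f)).

Let solution_ofP f : is_solution f (solution_of f).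
Proof. exact: projT2 (cid (exists_solution f)). Qed.

Let Fixpoint query_all (s : seq L) (g : L -> L) : tarski_algorithm m :=
  match s with
  | [::] => Output (solution_of g)
  | x :: s' => Query x (fun v => query_all s' (fun y => if y == x then v else g y))
  end.

Let run_query_all (f g : L -> L) s :
  (forall x, x \notin s -> g x = f x) -> run (query_all s g) f = solution_of f.
Proof.
elim: s g => [|x s IHs] g gf /=.
  by congr solution_of; apply: funext => y; exact: gf.
apply: IHs => y ys; case: eqP => [->//|/eqP yx].
by apply: gf; rewrite inE negb_or yx.
Qed.

Lemma query_complexityP : is_query_complexity m (query_complexity m).
Proof.
apply: xgetPex.
pose P q := `[< exists2 t, solves_tarski t & worst_case_queries (m := m) t = q >].
have exP : exists q, P q.
  exists (worst_case_queries (query_all (enum {: L}) id)); apply/asboolP.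
  exists (query_all (enum {: L}) id) => // f.
  by rewrite run_query_all // => x; rewrite mem_enum.
have [q /asboolP Pq qmin] := ex_minnP exP.
by exists q; split => // t tP; apply: qmin; apply/asboolP; exists t.
Qed.

End WellDefined.

(* Main.v *)
(* Upper bound.  A box [a, b] with a <= f a and f b <= b is halved by finding,
   on its middle slice, a point that f moves weakly up or weakly down in all
   three coordinates.  On a slice such a point is found by a planar binary
   search costing a constant number of queries per halving.  An algorithm for
   monotone f serves arbitrary f: as long as the answers received violate no
   monotonicity, they are those of some monotone function.
   Lower bound.  The hard instances live in the plane.  A staircase runs
   through the grid, points off the staircase move diagonally towards it, and
   points on it move along it towards one of its corners, the only fixed point.
   An adversary keeps an interval for the position of each step; a query halves
   at most two of them, after which its answer no longer depends on the fixed
   corner.  Only after about log n halvings is the adversary forced to give up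
   half of the candidate corners, which it can do about log n times. *)
From Stdlib Require Import ZArith List Lia.
From mathcomp Require Import all_boot all_order all_algebra.
From mathcomp Require Import all_classical all_reals all_analysis.
From mathcomp Require Import zify ring.
Require Import Defs.
Import numFieldNormedType.Exports.

Set Implicit Arguments.
Unset Strict Implicit.
Unset Printing Implicit Defensive.

(** * Query algorithms under a promise, and their composition *)

Section Finds.
Variables X Y : Type.

Fixpoint bind A B (t : algorithm X Y A) (k : A -> algorithm X Y B) : algorithm X Y B :=
  match t with
  | Output a => k a
  | Query x next => Query x (fun v => bind (next v) k)
  end.

Lemma run_bind A B (t : algorithm X Y A) (k : A -> algorithm X Y B) f :
  run (bind t k) f = run (k (run t f)) f.
Proof. by elim: t => //= x next IH; rewrite IH. Qed.

Lemma num_queries_bind A B (t : algorithm X Y A) (k : A -> algorithm X Y B) f :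
  num_queries (bind t k) f = num_queries t f + num_queries (k (run t f)) f.
Proof. by elim: t => //= x next IH; rewrite IH addSn. Qed.

(** The promise [H] also carries what the answers so far have revealed, so a search can be assembled
    answer by answer instead of being written as an explicit tree. *)
Definition finds A (q : nat) (H : (X -> Y) -> Prop) (G : (X -> Y) -> A -> Prop) : Prop :=
  exists t : algorithm X Y A, forall f, H f -> G f (run t f) /\ num_queries t f <= q.

Lemma finds_output A (a : A) q (H : (X -> Y) -> Prop) (G : (X -> Y) -> A -> Prop) :
  (forall f, H f -> G f a) -> finds q H G.
Proof. by move=> h; exists (Output a) => f /h. Qed.

Lemma finds_query A x q (H : (X -> Y) -> Prop) (G : (X -> Y) -> A -> Prop) :
  (forall v, finds q (fun f => H f /\ f x = v) G) -> finds q.+1 H G.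
Proof.
move=> /choice[k hk]; exists (Query x k) => f Hf /=.
by have [] := hk (f x) f (conj Hf erefl).
Qed.

Lemma finds_weaken A B q q' (H H' : (X -> Y) -> Prop) (G : (X -> Y) -> A -> Prop)
    (G' : (X -> Y) -> B -> Prop) (h : A -> B) :
  q <= q' -> (forall f, H' f -> H f) -> (forall f a, H' f -> G f a -> G' f (h a)) ->
  finds q H G -> finds q' H' G'.
Proof.
move=> hq hH hG [t ht]; exists (bind t (fun a => Output (h a))) => f Hf.
have [Gt qt] := ht f (hH _ Hf); rewrite run_bind num_queries_bind addn0; split.
  exact: hG.
exact: leq_trans qt hq.
Qed.

Lemma finds_sub A q (H H' : (X -> Y) -> Prop) (G : (X -> Y) -> A -> Prop) :
  finds q H G -> (forall f, H' f -> H f) -> finds q H' G.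
Proof. by move=> [t ht] hH; exists t => f /hH/ht. Qed.

Lemma finds_bind A B q q' (H : (X -> Y) -> Prop) (G : (X -> Y) -> A -> Prop)
    (G' : (X -> Y) -> B -> Prop) :
  finds q H G -> (forall a, finds q' (fun f => H f /\ G f a) G') -> finds (q + q') H G'.
Proof.
move=> [t ht] /choice[k hk]; exists (bind t k) => f Hf.
have [Gt qt] := ht f Hf; rewrite run_bind num_queries_bind.
by have [? ?] := hk (run t f) f (conj Hf Gt); split=> //; apply: leq_add.
Qed.

(* Queries made non-adaptively: it is enough that a suitable outcome exists for
   each oracle, provided that suitability depends on the answers only. *)
Lemma finds_list A (a0 : A) (l : list X) (H : (X -> Y) -> Prop) (G : (X -> Y) -> A -> Prop) :
  (forall f, H f -> exists a, G f a) ->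
  (forall f g a, H f -> H g -> (forall x, In x l -> f x = g x) -> G f a -> G g a) ->
  finds (length l) H G.
Proof.
elim: l H => [|x l IH] H ex loc.
  (* If no oracle meets the promise, every output is correct and [a0] is returned. *)
  have [[f Hf]|no] := pselect (exists f, H f).
    by have [a Ga] := ex f Hf; apply: (@finds_output _ a) => g Hg; apply: loc Ga.
  by apply: (@finds_output _ a0) => f Hf; case: no; exists f.
apply: (@finds_query _ x) => v; apply: IH => [f [Hf _]|f g a [Hf fv] [Hg gv] fg].
  exact: ex.
by apply: loc => // y [<-|]; [rewrite fv gv|exact: fg].
Qed.
End Finds.

Fixpoint translate X Y X' Y' A (phi : X -> X') (psi : Y' -> Y) (t : algorithm X Y A) :
    algorithm X' Y' A :=
  match t with
  | Output a => Output a
  | Query x next => Query (phi x) (fun v => translate phi psi (next (psi v)))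
  end.

Lemma run_translate X Y X' Y' A (phi : X -> X') (psi : Y' -> Y) (t : algorithm X Y A) f :
  run (translate phi psi t) f = run t (psi \o f \o phi) /\
  num_queries (translate phi psi t) f = num_queries t (psi \o f \o phi).
Proof. by elim: t => //= x next IH; have [-> ->] := IH (psi (f (phi x))). Qed.

Lemma finds_translate X Y X' Y' A (phi : X -> X') (psi : Y' -> Y) q
    (H : (X -> Y) -> Prop) (G : (X -> Y) -> A -> Prop) :
  finds q H G ->
  finds q (fun f => H (psi \o f \o phi)) (fun f a => G (psi \o f \o phi) a).
Proof.
by move=> [t ht]; exists (translate phi psi t) => f /ht; have [-> ->] := run_translate phi psi t f.
Qed.

(** * From monotone functions to arbitrary ones *)

Section FromMonotone.
Variables (k : nat) (m : 'I_k -> nat).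
Hypothesis m_gt0 : forall i, 0 < m i.
Local Notation L := (lattice m).

Definition clamp (M x : nat) : nat := maxn 1 (minn M x).

Lemma coord_bounds (x : L) i : 1 <= coord x i <= m i.
Proof. by have /forallP := valP x; apply. Qed.

Lemma coord_inj (x y : L) : (forall i, coord x i = coord y i) -> x = y.
Proof. by move=> h; apply/val_inj/ffunP => i; apply/val_inj; exact: h. Qed.

Definition clamp_ffun (h : 'I_k -> nat) : {ffun 'I_k -> 'I_(width m).+1} :=
  [ffun i => inord (clamp (m i) (h i))].

Lemma clamp_ffunE h i : clamp_ffun h i = clamp (m i) (h i) :> nat.
Proof.
rewrite ffunE inordK // ltnS; apply: leq_trans (leq_bigmax i).
by have := m_gt0 i; rewrite /clamp; lia.
Qed.

Lemma clamp_ffunP h : [forall i, 1 <= clamp_ffun h i <= m i].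
Proof.
by apply/forallP => i; rewrite clamp_ffunE; have := m_gt0 i; rewrite /clamp; lia.
Qed.

Definition clamp_point (h : 'I_k -> nat) : L := Sub (clamp_ffun h) (clamp_ffunP h).

Lemma coord_clamp_point h i : coord (clamp_point h) i = clamp (m i) (h i).
Proof. exact: clamp_ffunE. Qed.

Definition lattice_monotone (f : L -> L) : Prop :=
  forall x y, lattice_le x y -> lattice_le (f x) (f y).

Lemma lattice_le_refl (x : L) : lattice_le x x.
Proof. by apply/forallP. Qed.

Lemma lattice_le_trans (y x z : L) : lattice_le x y -> lattice_le y z -> lattice_le x z.
Proof.
by move=> /forallP xy /forallP yz; apply/forallP => i; apply: leq_trans (xy i) (yz i).
Qed.

Definition violations (s : seq (L * L)) : seq ((L * L) * (L * L)) :=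
  [seq p <- allpairs pair s s | lattice_le p.1.1 p.2.1 && ~~ lattice_le p.1.2 p.2.2].

Definition extends (f : L -> L) (s : seq (L * L)) : Prop :=
  forall p, p \in s -> f p.1 = p.2.

(** At [z] the extension takes the join of the values recorded at points below [z]. Without
    violations this join is the recorded value at a recorded point; clamping turns the empty join
    into 1. *)
Lemma monotone_extension s : violations s = [::] -> exists2 g, lattice_monotone g & extends g s.
Proof.
move=> nov.
have mono p q : p \in s -> q \in s -> lattice_le p.1 q.1 -> lattice_le p.2 q.2.
  move=> ps qs le; apply/negPn/negP => nle.
  have : (p, q) \in violations s by rewrite mem_filter /= le nle; apply: allpairs_f.
  by rewrite nov.
exists (fun z => clamp_point (fun i => \max_(p <- s | lattice_le p.1 z) coord p.2 i)).
  move=> x y xy; apply/forallP => i; rewrite !coord_clamp_point.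
  suff : \max_(p <- s | lattice_le p.1 x) coord p.2 i <=
         \max_(p <- s | lattice_le p.1 y) coord p.2 i by rewrite /clamp; lia.
  apply/bigmax_leqP_seq => p ps px; apply: leq_bigmax_seq => //.
  exact: lattice_le_trans px xy.
move=> p ps; apply: coord_inj => i; rewrite coord_clamp_point.
suff -> : \max_(q <- s | lattice_le q.1 p.1) coord q.2 i = coord p.2 i.
  by have := coord_bounds p.2 i; rewrite /clamp; lia.
apply/eqP; rewrite eqn_leq; apply/andP; split.
  by apply/bigmax_leqP_seq => q qs qp; have /forallP := mono q p qs ps qp; apply.
by apply: (leq_bigmax_seq _ ps); exact: lattice_le_refl.
Qed.

(** The default of [head] is harmless: the result is relied upon only when [violations s] is
    nonempty. *)
Definition report (s : seq (L * L)) : answer m :=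
  let p := head ((clamp_point (fun=> 1), clamp_point (fun=> 1)), (clamp_point (fun=> 1), clamp_point (fun=> 1)))
             (violations s) in
  Violation p.1.1 p.2.1.

Lemma reportP f s : extends f s -> violations s != [::] -> is_solution f (report s).
Proof.
move=> fs; rewrite /report; case e: (violations s) => [//|p v] _ /=.
have : p \in violations s by rewrite e mem_head.
rewrite mem_filter => /andP[/andP[le nle] /allpairsP[[a b] /= [as_ bs pe]]].
move: le nle; rewrite pe /= => le nle.
by rewrite (fs a as_) (fs b bs); split=> //; exact/negP.
Qed.

Fixpoint guard (t : algorithm L L L) (s : seq (L * L)) : tarski_algorithm m :=
  match t with
  | Output x => Query x (fun v =>
      Output (if v == x then FixedPoint x else report ((x, v) :: s)))
  | Query x next => Query x (fun v =>
      if violations ((x, v) :: s) == [::] then guard (next v) ((x, v) :: s)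
      else Output (report ((x, v) :: s)))
  end.

(** While the record shows no violation it is shared by a monotone function, on which [t] is correct
    and within its budget. If the proposed output is not fixed by [f], no monotone function shares
    the record, which therefore holds a violation; this last check is the extra query. *)
Lemma guardP q t s f : extends f s -> violations s = [::] ->
  (forall g, lattice_monotone g -> extends g s -> g (run t g) = run t g /\ num_queries t g <= q) ->
  is_solution f (run (guard t s) f) /\ num_queries (guard t s) f <= q.+1.
Proof.
elim: t q s => [x|x next IH] q s fs nov ht /=.
  have fs' : extends f ((x, f x) :: s) by move=> p; rewrite inE => /predU1P[->|/fs].
  split=> //; case: eqP => [//|fx]; apply: reportP => //; apply/eqP => nov'.
  have [g gm gs] := monotone_extension nov'.
  have [/= gx _] : g (run (Output x) g) = run (Output x) g /\ num_queries (Output x) g <= q.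
    by apply: ht => // p ps; apply: gs; rewrite inE ps orbT.
  by apply: fx; rewrite -[RHS]gx; symmetry; exact: (gs (x, f x) (mem_head _ _)).
have fs' : extends f ((x, f x) :: s) by move=> p; rewrite inE => /predU1P[->|/fs].
have [nov'|vio] := eqVneq; last by split=> //; exact: reportP.
have hx g : extends g ((x, f x) :: s) -> g x = f x /\ extends g s.
  move=> gs; split; first exact: (gs (x, f x) (mem_head _ _)).
  by move=> p ps; apply: gs; rewrite inE ps orbT.
have [g gm gs] := monotone_extension nov'.
(* A budget of 0 is contradictory: the monotone extension [g] is itself charged for this query. *)
case: q ht => [|q] ht.
  by have [_ gs'] := hx g gs; have [] := ht g gm gs'.
apply: (IH (f x) q) => // g' gm' gs'.
by have [e gs2] := hx g' gs'; have := ht g' gm' gs2; rewrite /= e => -[? ?]; split=> //; lia.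
Qed.
End FromMonotone.

(** * Planar search: boxes that must contain a settled point, and how to halve them *)

Section Planar.
Local Open Scope Z_scope.

Definition monoZ2 (F : Z -> Z -> Z) : Prop :=
  forall x y x' y', x <= x' -> y <= y' -> F x y <= F x' y'.

(** On a slice, [A] and [B] are the planar coordinates of the image and [C] is the displacement in
    the third coordinate. *)
Definition settled (A B C : Z -> Z -> Z) (x y : Z) : Prop :=
  (x <= A x y /\ y <= B x y /\ 0 <= C x y) \/
  (A x y <= x /\ B x y <= y /\ C x y <= 0).

(* Besides its lower-left corner (bx0, by0) and its upper-right corner
   (bx1, by1), a box carries a witness on its upper or right side and one on its
   lower or left side, see [top_ok] and [bot_ok]. *)
Record box := Box { bx0 : Z; by0 : Z; bx1 : Z; by1 : Z;
                    top1 : Z; top2 : Z; bot1 : Z; bot2 : Z }.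

(** In the last two alternatives the coordinate along the side moves weakly forward at the witness
    and weakly backward at the corner, so it has a fixed point between them. There [C] is
    nonnegative, so that point either is settled or could serve as an upper corner of the first
    kind. *)
Definition top_ok (A B C : Z -> Z -> Z) (s : box) : Prop :=
  let: Box a1 a2 b1 b2 w1 w2 _ _ := s in
  0 <= C b1 b2 /\
  ((A b1 b2 <= b1 /\ B b1 b2 <= b2) \/
   (A b1 b2 <= b1 /\ w2 = b2 /\ a1 <= w1 <= b1 /\ w1 <= A w1 w2 /\ 0 <= C w1 w2) \/
   (B b1 b2 <= b2 /\ w1 = b1 /\ a2 <= w2 <= b2 /\ w2 <= B w1 w2 /\ 0 <= C w1 w2)).

Definition bot_ok (A B C : Z -> Z -> Z) (s : box) : Prop :=
  let: Box a1 a2 b1 b2 _ _ u1 u2 := s in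
  C a1 a2 <= 0 /\
  ((a1 <= A a1 a2 /\ a2 <= B a1 a2) \/
   (a1 <= A a1 a2 /\ u2 = a2 /\ a1 <= u1 <= b1 /\ A u1 u2 <= u1 /\ C u1 u2 <= 0) \/
   (a2 <= B a1 a2 /\ u1 = a1 /\ a2 <= u2 <= b2 /\ B u1 u2 <= u2 /\ C u1 u2 <= 0)).

Definition box_ok A B C s : Prop :=
  bx0 s <= bx1 s /\ by0 s <= by1 s /\ top_ok A B C s /\ bot_ok A B C s.

Definition corners (s : box) : list (Z * Z) :=
  (bx0 s, by0 s) :: (bx1 s, by1 s) :: (top1 s, top2 s) :: (bot1 s, bot2 s) :: nil.

Definition probes (s : box) (x y : Z) : list (Z * Z) :=
  (x, y) :: (bx0 s, y) :: (bx1 s, y) :: (x, by0 s) :: (x, by1 s) :: corners s.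

Definition settled_in A B C (s : box) (l : list (Z * Z)) : Prop :=
  exists p1 p2, In (p1, p2) l /\ settled A B C p1 p2 /\
    bx0 s <= p1 <= bx1 s /\ by0 s <= p2 <= by1 s.

Definition subbox (s' s : box) : Prop :=
  bx0 s <= bx0 s' /\ bx1 s' <= bx1 s /\ by0 s <= by0 s' /\ by1 s' <= by1 s.

(** The corners and witnesses of the new box must lie in [l], so that its validity depends only on
    values at points of [l]. *)
Definition refined_in A B C (s : box) (l : list (Z * Z)) (P : box -> Prop) : Prop :=
  exists s', box_ok A B C s' /\ subbox s' s /\ List.incl (corners s') l /\ P s'.

Definition ycut (y : Z) (s : box) : Prop := by0 s = y \/ by1 s = y.
Definition xcut (x : Z) (s : box) : Prop := bx0 s = x \/ bx1 s = x.

Ltac member := by rewrite /probes /corners /=; tauto.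
Ltac solved p1 p2 :=
  left; exists p1, p2; split; [member | split; [rewrite /settled; lia | simpl; lia]].
Ltac refined_by a1 a2 b1 b2 w1 w2 u1 u2 :=
  right; exists (Box a1 a2 b1 b2 w1 w2 u1 u2); split;
  [rewrite /box_ok /top_ok /bot_ok /=; lia
  | split; [rewrite /subbox /=; lia
  | split; [by move=> p; rewrite /probes /corners /=; tauto
  | rewrite /ycut /xcut /=; lia]]].

Section Step.
Variables (A B C : Z -> Z -> Z).
Hypotheses (mA : monoZ2 A) (mB : monoZ2 B) (mC : monoZ2 C).

Ltac mono x y x' y' :=
  have := mA (x := x) (y := y) (x' := x') (y' := y');
  have := mB (x := x) (y := y) (x' := x') (y' := y');
  have := mC (x := x) (y := y) (x' := x') (y' := y').

(** The aim is to keep the lower half, with [(x, y)] as witness on its upper side. This can fail in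
    two ways. The first coordinate may leave the box at [(b1, y)]; then the top witness is on the
    right side. Or the bottom witness may lie on the left side above [y]; then [(a1, y)] is settled,
    or becomes the lower corner of the upper half, or replaces that witness. *)
Lemma ystep_right_up s x y :
  box_ok A B C s -> bx0 s <= x <= bx1 s -> by0 s <= y <= by1 s ->
  x <= A x y -> B x y <= y -> 0 <= C x y ->
  settled_in A B C s (probes s x y) \/ refined_in A B C s (probes s x y) (ycut y).
Proof.
case: s => a1 a2 b1 b2 w1 w2 u1 u2; rewrite /box_ok /top_ok /bot_ok /=.
move=> [hx [hy [[Cb top] [Ca bot]]]] xab yab Ax Bx Cx.
have Cr : 0 <= C b1 y by mono x y b1 y; lia.
have lr : B a1 y <= B b1 y by apply: mB; lia.
have Alq : A a1 y <= A x y by apply: mA; lia.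
have bot' : (u1 = a1 /\ y < u2 <= b2 /\ a2 <= B a1 a2 /\ B u1 u2 <= u2 /\ C u1 u2 <= 0) \/
   ((a1 <= A a1 a2 /\ a2 <= B a1 a2) \/
   (a1 <= A a1 a2 /\ u2 = a2 /\ a1 <= u1 <= b1 /\ A u1 u2 <= u1 /\ C u1 u2 <= 0) \/
   (a2 <= B a1 a2 /\ u1 = a1 /\ a2 <= u2 <= y /\ B u1 u2 <= u2 /\ C u1 u2 <= 0)) by lia.
have Bab : B a1 a2 <= B b1 b2 by apply: mB; lia.
have Arb : A b1 y <= A b1 b2 by apply: mA; lia.
have [Ar|Ar] : A b1 y <= b1 \/ b1 < A b1 y by lia.
  case: bot' => [[e [hu [Ba [Bu Cu]]]]|bot']; last by refined_by a1 a2 b1 y x y u1 u2.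
  subst u1; have Cl : C a1 y <= 0 by mono a1 y a1 u2; lia.
  have [Bl|Bl] : y <= B a1 y \/ B a1 y < y by lia.
    case: top => [top|[top|top]].
    - by refined_by a1 y b1 b2 w1 w2 a1 u2.
    - by refined_by a1 y b1 b2 w1 w2 a1 u2.
    - have [hw|hw] : y <= w2 \/ w2 < y by lia.
        by refined_by a1 y b1 b2 w1 w2 a1 u2.
      by refined_by a1 y b1 b2 b1 y a1 u2.
  have [Al|Al] : A a1 y <= a1 \/ a1 < A a1 y by lia.
    by solved a1 y.
  by refined_by a1 a2 b1 y x y a1 y.
(* Here [b1 < A b1 y <= A b1 b2], which excludes the alternatives where the corner moves weakly
   left. *)
have {}top : (B b1 b2 <= b2 /\ w1 = b1 /\ a2 <= w2 <= b2 /\ w2 <= B w1 w2 /\ 0 <= C w1 w2).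
  by lia.
have ew : w1 = b1 by lia.
subst w1.
have [hw|hw] : y < w2 \/ w2 <= y by lia.
  have Aw : A b1 y <= A b1 w2 by apply: mA; lia.
  by solved b1 w2.
have [Br|Br] : y < B b1 y \/ B b1 y <= y by lia.
  by solved b1 y.
case: bot' => [[e [hu [Ba [Bu Cu]]]]|bot']; last by refined_by a1 a2 b1 y b1 w2 u1 u2.
subst u1; have Cl : C a1 y <= 0 by mono a1 y a1 u2; lia.
have [Bl|Bl] : y <= B a1 y \/ B a1 y < y by lia.
  by refined_by a1 y b1 b2 b1 y a1 u2.
have [Al|Al] : A a1 y <= a1 \/ a1 < A a1 y by lia.
  by solved a1 y.
by refined_by a1 a2 b1 y b1 w2 a1 y.
Qed.

(** Unless it is settled, the point becomes the lower-left corner, so both sides are cut. A top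
    witness lost by this is replaced by the projection of [(x, y)] to the side of that witness,
    which qualifies by monotonicity. *)
Lemma ystep_up s x y :
  box_ok A B C s -> bx0 s <= x <= bx1 s -> by0 s <= y <= by1 s ->
  x <= A x y -> y <= B x y ->
  settled_in A B C s (probes s x y) \/ refined_in A B C s (probes s x y) (fun s' => ycut y s' /\ xcut x s').
Proof.
case: s => a1 a2 b1 b2 w1 w2 u1 u2; rewrite /box_ok /top_ok /bot_ok /=.
move=> [hx [hy [[Cb top] [Ca bot]]]] xab yab Ax Bx.
have [Cx|Cx] : 0 <= C x y \/ C x y <= 0 by lia.
  by solved x y.
case: top => [top|[top|top]].
- by refined_by x y b1 b2 w1 w2 x y.
- have [hw|hw] : x <= w1 \/ w1 < x by lia.
    by refined_by x y b1 b2 w1 w2 x y.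
  have e : w2 = b2 by lia.
  subst w2; mono x y x b2; mono w1 b2 x b2 => *.
  by refined_by x y b1 b2 x b2 x y.
- have [hw|hw] : y <= w2 \/ w2 < y by lia.
    by refined_by x y b1 b2 w1 w2 x y.
  have e : w1 = b1 by lia.
  subst w1; mono x y b1 y; mono b1 w2 b1 y => *.
  by refined_by x y b1 b2 b1 y x y.
Qed.

(** By monotonicity the lower-left corner is moved out of the box as well, which leaves only the
    alternative of a bottom witness on the left side. *)
Lemma ystep_left_edge s y :
  box_ok A B C s -> by0 s <= y <= by1 s -> A (bx0 s) y <= bx0 s - 1 ->
  settled_in A B C s (probes s (bx0 s) y) \/ refined_in A B C s (probes s (bx0 s) y) (ycut y).
Proof.
case: s => a1 a2 b1 b2 w1 w2 u1 u2; rewrite /box_ok /top_ok /bot_ok /=.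
move=> [hx [hy [[Cb top] [Ca bot]]]] yab Al.
mono a1 a2 a1 y => mC1 mB1 mA1.
have {}bot : (a2 <= B a1 a2 /\ u1 = a1 /\ a2 <= u2 <= b2 /\ B u1 u2 <= u2 /\ C u1 u2 <= 0).
  by lia.
have e : u1 = a1 by lia.
subst u1.
have [hu|hu] : u2 < y \/ y <= u2 by lia.
  have Aw : A a1 u2 <= A a1 y by apply: mA; lia.
  by solved a1 u2.
have Cl : C a1 y <= 0 by mono a1 y a1 u2; lia.
have [Bl|Bl] : y <= B a1 y \/ B a1 y < y by lia.
  case: top => [top|[top|top]].
  - by refined_by a1 y b1 b2 w1 w2 a1 u2.
  - by refined_by a1 y b1 b2 w1 w2 a1 u2.
  - have [hw|hw] : y <= w2 \/ w2 < y by lia.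
      by refined_by a1 y b1 b2 w1 w2 a1 u2.
    have e : w1 = b1 by lia.
    subst w1; mono a1 y b1 y; mono b1 w2 b1 y => *.
    by refined_by a1 y b1 b2 b1 y a1 u2.
by solved a1 y.
Qed.

End Step.

(** Reflection through the origin reverses the order and exchanges top with bottom. Together with
    the exchange of the two axes it reduces the remaining directions to those treated above. *)
Definition dualF (F : Z -> Z -> Z) (x y : Z) : Z := - F (- x) (- y).
Definition dual_box (s : box) : box :=
  let: Box a1 a2 b1 b2 w1 w2 u1 u2 := s in
  Box (- b1) (- b2) (- a1) (- a2) (- u1) (- u2) (- w1) (- w2).
Definition dual_pt (p : Z * Z) : Z * Z := (- p.1, - p.2).

Definition swapF (F : Z -> Z -> Z) (x y : Z) : Z := F y x.
Definition swap_box (s : box) : box :=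
  let: Box a1 a2 b1 b2 w1 w2 u1 u2 := s in Box a2 a1 b2 b1 w2 w1 u2 u1.
Definition swap_pt (p : Z * Z) : Z * Z := (p.2, p.1).

Lemma dualF_mono F : monoZ2 F -> monoZ2 (dualF F).
Proof. by move=> m x y x' y' hx hy; rewrite /dualF; have := m (- x') (- y') (- x) (- y); lia. Qed.

Lemma swapF_mono F : monoZ2 F -> monoZ2 (swapF F).
Proof. by move=> m x y x' y' hx hy; apply: m. Qed.

Lemma dual_box_ok A B C s :
  box_ok A B C s -> box_ok (dualF A) (dualF B) (dualF C) (dual_box s).
Proof.
case: s => a1 a2 b1 b2 w1 w2 u1 u2 H; rewrite /box_ok /top_ok /bot_ok /dual_box /dualF /= ?Z.opp_involutive in H *.
by lia.
Qed.

Lemma dual_boxK A B C s :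
  box_ok (dualF A) (dualF B) (dualF C) s -> box_ok A B C (dual_box s).
Proof.
case: s => a1 a2 b1 b2 w1 w2 u1 u2 H; rewrite /box_ok /top_ok /bot_ok /dual_box /dualF /= in H *.
by lia.
Qed.

Lemma swap_box_ok A B C s :
  box_ok (swapF B) (swapF A) (swapF C) s -> box_ok A B C (swap_box s).
Proof.
case: s => a1 a2 b1 b2 w1 w2 u1 u2 H; rewrite /box_ok /top_ok /bot_ok /swap_box /swapF /= in H *.
by lia.
Qed.

Lemma In_dual p l : In p (List.map dual_pt l) -> In (dual_pt p) l.
Proof.
case/in_map_iff => -[q1 q2] [<-] h.
by rewrite /dual_pt /= !Z.opp_involutive.
Qed.

Lemma In_swap p l : In p (List.map swap_pt l) -> In (swap_pt p) l.
Proof. by case/in_map_iff => -[q1 q2] [<-] h. Qed.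

Lemma settled_in_dual A B C s l :
  settled_in (dualF A) (dualF B) (dualF C) (dual_box s) (List.map dual_pt l) ->
  settled_in A B C s l.
Proof.
case: s => a1 a2 b1 b2 w1 w2 u1 u2 [p1 [p2 [/In_dual hp [hs hb]]]].
exists (- p1), (- p2); split=> //.
by rewrite /settled /dualF /= in hs hb *; lia.
Qed.

Lemma settled_in_swap A B C s l :
  settled_in (swapF B) (swapF A) (swapF C) (swap_box s) (List.map swap_pt l) ->
  settled_in A B C s l.
Proof.
case: s => a1 a2 b1 b2 w1 w2 u1 u2 [p1 [p2 [/In_swap hp [hs hb]]]].
exists p2, p1; split=> //.
by rewrite /settled /swapF /= in hs hb *; lia.
Qed.

Lemma refined_in_dual A B C s l (P : box -> Prop) :
  refined_in (dualF A) (dualF B) (dualF C) (dual_box s) (List.map dual_pt l)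
    (fun s' => P (dual_box s')) ->
  refined_in A B C s l P.
Proof.
case=> s' [/dual_boxK h1 [h2 [h3 h4]]]; exists (dual_box s').
split=> //; split; first by case: s s' h2 {h1 h3 h4} => [? ? ? ? ? ? ? ?] [? ? ? ? ? ? ? ?]; rewrite /subbox /= => ?; lia.
split=> // p hp; have -> : p = dual_pt (dual_pt p).
  by case: p {hp} => p1 p2; rewrite /dual_pt /= !Z.opp_involutive.
apply/In_dual/h3; case: s' {h1 h2 h3 h4} hp => [? ? ? ? ? ? ? ?] /=; rewrite /dual_pt.
by do !case=> [<- /=|]; rewrite ?Z.opp_involutive; tauto.
Qed.

Lemma refined_in_swap A B C s l (P : box -> Prop) :
  refined_in (swapF B) (swapF A) (swapF C) (swap_box s) (List.map swap_pt l)
    (fun s' => P (swap_box s')) ->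
  refined_in A B C s l P.
Proof.
case=> s' [/swap_box_ok h1 [h2 [h3 h4]]]; exists (swap_box s').
split=> //; split; first by case: s s' h2 {h1 h3 h4} => [? ? ? ? ? ? ? ?] [? ? ? ? ? ? ? ?]; rewrite /subbox /= => ?; lia.
split=> // p hp; have -> : p = swap_pt (swap_pt p) by case: p {hp}.
apply/In_swap/h3; case: s' {h1 h2 h3 h4} hp => [? ? ? ? ? ? ? ?] /=; rewrite /swap_pt.
by do !case=> [<- /=|]; tauto.
Qed.

Lemma settled_in_incl A B C s l l' : List.incl l l' -> settled_in A B C s l -> settled_in A B C s l'.
Proof. by move=> h [p1 [p2 [/h hp [? ?]]]]; exists p1, p2. Qed.

Lemma refined_in_incl A B C s l l' (P Q : box -> Prop) :
  List.incl l l' -> (forall s', subbox s' s -> P s' -> Q s') ->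
  refined_in A B C s l P -> refined_in A B C s l' Q.
Proof.
move=> h PQ [s' [h1 [h2 [h3 h4]]]]; exists s'; split=> //; split=> //; split; last exact: PQ.
by move=> p /h3/h.
Qed.

(** With sides at most 1 a witness that counts is a corner, so the claim is linear arithmetic about
    the twelve values of [A], [B], [C] at the four corners. *)
Lemma small_box_settled A B C a1 a2 b1 b2 w1 w2 u1 u2 :
  let s := Box a1 a2 b1 b2 w1 w2 u1 u2 in
  monoZ2 A -> monoZ2 B -> monoZ2 C ->
  box_ok A B C s -> b1 - a1 <= 1 -> b2 - a2 <= 1 ->
  settled_in A B C s ((a1, a2) :: (a1, b2) :: (b1, a2) :: (b1, b2) :: nil).
Proof.
move=> s mA mB mC; rewrite /s /box_ok /top_ok /bot_ok /=.
move=> [hx [hy [[Cb top] [Ca bot]]]] w h.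
have A1 : A a1 a2 <= A a1 b2 by apply: mA; lia.
have A2 : A a1 a2 <= A b1 a2 by apply: mA; lia.
have A3 : A a1 b2 <= A b1 b2 by apply: mA; lia.
have A4 : A b1 a2 <= A b1 b2 by apply: mA; lia.
have B1 : B a1 a2 <= B a1 b2 by apply: mB; lia.
have B2 : B a1 a2 <= B b1 a2 by apply: mB; lia.
have B3 : B a1 b2 <= B b1 b2 by apply: mB; lia.
have B4 : B b1 a2 <= B b1 b2 by apply: mB; lia.
have C1 : C a1 a2 <= C a1 b2 by apply: mC; lia.
have C2 : C a1 a2 <= C b1 a2 by apply: mC; lia.
have C3 : C a1 b2 <= C b1 b2 by apply: mC; lia.
have C4 : C b1 a2 <= C b1 b2 by apply: mC; lia.
have {}top : (A b1 b2 <= b1 /\ B b1 b2 <= b2) \/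
   (A b1 b2 <= b1 /\ a1 <= A a1 b2 /\ 0 <= C a1 b2) \/
   (A b1 b2 <= b1 /\ b1 <= A b1 b2 /\ 0 <= C b1 b2) \/
   (B b1 b2 <= b2 /\ a2 <= B b1 a2 /\ 0 <= C b1 a2) \/
   (B b1 b2 <= b2 /\ b2 <= B b1 b2 /\ 0 <= C b1 b2).
  case: top => [|[[? [e [hw ?]]]|[? [e [hw ?]]]]]; first (by left); subst.
    have [e|e] : w1 = a1 \/ w1 = b1 by lia.
      by subst; lia.
    by subst; lia.
  have [e|e] : w2 = a2 \/ w2 = b2 by lia.
    by subst; lia.
  by subst; lia.
have {}bot : (a1 <= A a1 a2 /\ a2 <= B a1 a2) \/
   (a1 <= A a1 a2 /\ A a1 a2 <= a1 /\ C a1 a2 <= 0) \/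
   (a1 <= A a1 a2 /\ A b1 a2 <= b1 /\ C b1 a2 <= 0) \/
   (a2 <= B a1 a2 /\ B a1 a2 <= a2 /\ C a1 a2 <= 0) \/
   (a2 <= B a1 a2 /\ B a1 b2 <= b2 /\ C a1 b2 <= 0).
  case: bot => [|[[? [e [hw ?]]]|[? [e [hw ?]]]]]; first (by left); subst.
    have [e|e] : u1 = a1 \/ u1 = b1 by lia.
      by subst; lia.
    by subst; lia.
  have [e|e] : u2 = a2 \/ u2 = b2 by lia.
    by subst; lia.
  by subst; lia.
have sol p1 p2 : In (p1, p2) ((a1, a2) :: (a1, b2) :: (b1, a2) :: (b1, b2) :: nil) ->
   settled A B C p1 p2 -> settled_in A B C s ((a1, a2) :: (a1, b2) :: (b1, a2) :: (b1, b2) :: nil).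
  move=> hp hs; exists p1, p2; split=> //; split=> //.
  by case: hp => [[<- <-]|[[<- <-]|[[<- <-]|[[<- <-]|[]]]]] /=; lia.
have : settled A B C a1 a2 \/ settled A B C a1 b2 \/ settled A B C b1 a2 \/ settled A B C b1 b2.
  rewrite /settled.
  clear sol s mA mB mC w1 w2 u1 u2.
  move: A1 A2 A3 A4 B1 B2 B3 B4 C1 C2 C3 C4 top bot Ca Cb.
  move: (A a1 a2) (A a1 b2) (A b1 a2) (A b1 b2) => A00 A01 A10 A11.
  move: (B a1 a2) (B a1 b2) (B b1 a2) (B b1 b2) => B00 B01 B10 B11.
  move: (C a1 a2) (C a1 b2) (C b1 a2) (C b1 b2) => C00 C01 C10 C11.
  move=> *.
  lia.
case=> [|[|[|]]]; apply: sol => /=; tauto.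
Qed.

Lemma probes_dual s x y : List.incl (probes (dual_box s) (- x) (- y)) (List.map dual_pt (probes s x y)).
Proof. by case: s => a1 a2 b1 b2 w1 w2 u1 u2 p; rewrite /= /dual_pt /=; tauto. Qed.

Lemma probes_swap s x y : List.incl (probes (swap_box s) y x) (List.map swap_pt (probes s x y)).
Proof. by case: s => a1 a2 b1 b2 w1 w2 u1 u2 p; rewrite /= /swap_pt /=; tauto. Qed.

Section Steps.
Variables (A B C : Z -> Z -> Z).
Hypotheses (mA : monoZ2 A) (mB : monoZ2 B) (mC : monoZ2 C).

Lemma dual_outcome s x y (P Q : box -> Prop) :
  (forall s', P s' -> Q (dual_box s')) ->
  settled_in (dualF A) (dualF B) (dualF C) (dual_box s) (probes (dual_box s) (- x) (- y)) \/
  refined_in (dualF A) (dualF B) (dualF C) (dual_box s) (probes (dual_box s) (- x) (- y)) P ->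
  settled_in A B C s (probes s x y) \/ refined_in A B C s (probes s x y) Q.
Proof.
move=> PQ [h|h]; [left|right].
  by apply: settled_in_dual; apply: settled_in_incl h; exact: probes_dual.
apply: refined_in_dual; apply: refined_in_incl h => [|s' _]; [exact: probes_dual|exact: PQ].
Qed.

Lemma ystep_left_down s x y :
  box_ok A B C s -> bx0 s <= x <= bx1 s -> by0 s <= y <= by1 s ->
  A x y <= x -> y <= B x y -> C x y <= 0 ->
  settled_in A B C s (probes s x y) \/ refined_in A B C s (probes s x y) (ycut y).
Proof.
move=> ok hx hy h1 h2 h3.
apply: (@dual_outcome s x y (ycut (- y))); first by case=> ? ? ? ? ? ? ? ?; rewrite /ycut /= => ?; lia.
apply: ystep_right_up; rewrite /dualF ?Z.opp_involutive; try lia;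
  try exact: dualF_mono; try exact: dual_box_ok;
  by case: s ok hx hy => [? ? ? ? ? ? ? ?] /=; lia.
Qed.

Lemma ystep_down s x y :
  box_ok A B C s -> bx0 s <= x <= bx1 s -> by0 s <= y <= by1 s ->
  A x y <= x -> B x y <= y ->
  settled_in A B C s (probes s x y) \/
  refined_in A B C s (probes s x y) (fun s' => ycut y s' /\ xcut x s').
Proof.
move=> ok hx hy h1 h2.
apply: (@dual_outcome s x y (fun s' => ycut (- y) s' /\ xcut (- x) s')).
  by case=> ? ? ? ? ? ? ? ?; rewrite /ycut /xcut /= => ?; lia.
apply: ystep_up; rewrite /dualF ?Z.opp_involutive; try lia;
  try exact: dualF_mono; try exact: dual_box_ok;
  by case: s ok hx hy => [? ? ? ? ? ? ? ?] /=; lia.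
Qed.

Lemma ystep_right_edge s y :
  box_ok A B C s -> by0 s <= y <= by1 s -> bx1 s + 1 <= A (bx1 s) y ->
  settled_in A B C s (probes s (bx1 s) y) \/
  refined_in A B C s (probes s (bx1 s) y) (ycut y).
Proof.
move=> ok hy h.
apply: (@dual_outcome s (bx1 s) y (ycut (- y))); first by case=> ? ? ? ? ? ? ? ?; rewrite /ycut /= => ?; lia.
have -> : - bx1 s = bx0 (dual_box s) by case: (s).
apply: ystep_left_edge; rewrite /dualF;
  try exact: dualF_mono; try exact: dual_box_ok;
  by case: s ok hy h => [? ? ? ? ? ? ? ?] /=; rewrite ?Z.opp_involutive; lia.
Qed.

(* Two adjacent columns suffice: if the first coordinate points strictly right
   on the left one, it points weakly right on the right one. *)
Lemma thin_ystep s y :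
  box_ok A B C s -> by0 s <= y <= by1 s -> bx1 s - bx0 s <= 1 ->
  settled_in A B C s (probes s (bx0 s) y ++ probes s (bx1 s) y)%list \/
  refined_in A B C s (probes s (bx0 s) y ++ probes s (bx1 s) y)%list (ycut y).
Proof.
move=> ok hy hw.
have hx : bx0 s <= bx1 s by case: ok.
set l := (X in settled_in _ _ _ _ X).
have i0 : List.incl (probes s (bx0 s) y) l by apply: incl_appl; exact: incl_refl.
have i1 : List.incl (probes s (bx1 s) y) l by apply: incl_appr; exact: incl_refl.
have wrap x (P : box -> Prop) : List.incl (probes s x y) l -> (forall s', P s' -> ycut y s') ->
    settled_in A B C s (probes s x y) \/ refined_in A B C s (probes s x y) P ->
    settled_in A B C s l \/ refined_in A B C s l (ycut y).
  move=> hi hP [h|h]; [left; exact: settled_in_incl h|right].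
  by apply: refined_in_incl h => // s' _; apply: hP.
have updown x : bx0 s <= x <= bx1 s -> List.incl (probes s x y) l -> A x y = x ->
    settled_in A B C s l \/ refined_in A B C s l (ycut y).
  move=> hxx hi e; have [h|h] : y <= B x y \/ B x y <= y by lia.
    apply: (wrap _ _ hi _ (ystep_up mA mB mC ok hxx hy _ h)); [by move=> s' []|lia].
  apply: (wrap _ _ hi _ (ystep_down ok hxx hy _ h)); [by move=> s' []|lia].
have [h|[h|h]] : A (bx0 s) y <= bx0 s - 1 \/ A (bx0 s) y = bx0 s \/ bx0 s < A (bx0 s) y by lia.
- exact: (wrap _ _ i0 _ (ystep_left_edge mA mB mC ok hy h)).
- by apply: updown h => //; lia.
have m := @mA (bx0 s) y (bx1 s) y hx (Z.le_refl _).
have [h'|h'] : A (bx1 s) y = bx1 s \/ bx1 s + 1 <= A (bx1 s) y by lia.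
  by apply: updown h' => //; lia.
exact: (wrap _ _ i1 _ (ystep_right_edge ok hy h')).
Qed.
End Steps.

Section Swapped.
Variables (A B C : Z -> Z -> Z).
Hypotheses (mA : monoZ2 A) (mB : monoZ2 B) (mC : monoZ2 C).

Lemma swap_outcome s l l' (P Q : box -> Prop) :
  List.incl l (List.map swap_pt l') -> (forall s', P s' -> Q (swap_box s')) ->
  settled_in (swapF B) (swapF A) (swapF C) (swap_box s) l \/
  refined_in (swapF B) (swapF A) (swapF C) (swap_box s) l P ->
  settled_in A B C s l' \/ refined_in A B C s l' Q.
Proof.
move=> hl PQ [h|h]; [left|right].
  by apply: settled_in_swap; apply: settled_in_incl h.
by apply: refined_in_swap; apply: refined_in_incl h => // s' _; exact: PQ.
Qed.

Lemma swap_box_okV s : box_ok A B C s -> box_ok (swapF B) (swapF A) (swapF C) (swap_box s).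
Proof.
case: s => a1 a2 b1 b2 w1 w2 u1 u2 H; rewrite /box_ok /top_ok /bot_ok /swap_box /swapF /= in H *.
by lia.
Qed.

Lemma xstep_left_up s x y :
  box_ok A B C s -> bx0 s <= x <= bx1 s -> by0 s <= y <= by1 s ->
  A x y <= x -> y <= B x y -> 0 <= C x y ->
  settled_in A B C s (probes s x y) \/ refined_in A B C s (probes s x y) (xcut x).
Proof.
move=> ok hx hy h1 h2 h3.
apply: (swap_outcome (@probes_swap s x y) (P := ycut x)).
  by case=> ? ? ? ? ? ? ? ?; rewrite /ycut /xcut /= => ?; lia.
apply: ystep_right_up => //;
  try exact: swapF_mono; try exact: swap_box_okV;
  by case: s ok hx hy => [? ? ? ? ? ? ? ?].
Qed.

Lemma xstep_right_down s x y :
  box_ok A B C s -> bx0 s <= x <= bx1 s -> by0 s <= y <= by1 s ->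
  x <= A x y -> B x y <= y -> C x y <= 0 ->
  settled_in A B C s (probes s x y) \/ refined_in A B C s (probes s x y) (xcut x).
Proof.
move=> ok hx hy h1 h2 h3.
apply: (swap_outcome (@probes_swap s x y) (P := ycut x)).
  by case=> ? ? ? ? ? ? ? ?; rewrite /ycut /xcut /= => ?; lia.
apply: ystep_left_down => //;
  try exact: swapF_mono; try exact: swap_box_okV;
  by case: s ok hx hy => [? ? ? ? ? ? ? ?].
Qed.

Lemma thin_xstep s x :
  box_ok A B C s -> bx0 s <= x <= bx1 s -> by1 s - by0 s <= 1 ->
  settled_in A B C s (probes s x (by0 s) ++ probes s x (by1 s))%list \/
  refined_in A B C s (probes s x (by0 s) ++ probes s x (by1 s))%list (xcut x).
Proof.
move=> ok hx hw.
apply: (@swap_outcome s (probes (swap_box s) (bx0 (swap_box s)) x ++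
                         probes (swap_box s) (bx1 (swap_box s)) x)%list _ (ycut x)).
- have -> : bx0 (swap_box s) = by0 s by case: (s).
  have -> : bx1 (swap_box s) = by1 s by case: (s).
  by rewrite List.map_app; apply: incl_app; [apply: incl_appl|apply: incl_appr]; exact: probes_swap.
- by case=> ? ? ? ? ? ? ? ?; rewrite /ycut /xcut /= => ?; lia.
apply: thin_ystep;
  try exact: swapF_mono; try exact: swap_box_okV;
  by case: s ok hx hw => [? ? ? ? ? ? ? ?].
Qed.

Definition midpoint (a b : Z) : Z := a + (b - a) / 2.

Definition step_points (s : box) : list (Z * Z) :=
  let x := midpoint (bx0 s) (bx1 s) in let y := midpoint (by0 s) (by1 s) in
  (probes s x y ++ probes s (bx0 s) y ++ probes s (bx1 s) y ++
   probes s x (by0 s) ++ probes s x (by1 s))%list.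

Definition size_le (i j : nat) (s : box) : Prop :=
  bx1 s - bx0 s <= 2 ^ Z.of_nat i /\ by1 s - by0 s <= 2 ^ Z.of_nat j.

Lemma midpointP a b : a <= b -> a <= midpoint a b <= b.
Proof. by move=> h; rewrite /midpoint; Z.div_mod_to_equations; lia. Qed.

Lemma half_le a b c d (i : nat) : a <= c -> d <= b -> b - a <= 2 ^ Z.of_nat i.+1 ->
  c = midpoint a b \/ d = midpoint a b -> d - c <= 2 ^ Z.of_nat i.
Proof.
move=> ac db; rewrite Nat2Z.inj_succ Z.pow_succ_r; last exact: Zle_0_nat.
by rewrite /midpoint; Z.div_mod_to_equations; lia.
Qed.

(** The directions at the midpoint choose the cut. If the planar coordinates agree, the midpoint is
    settled or becomes a corner; if they disagree, the sign of [C] tells which axis to cut. Once one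
    exponent is 0, the other side is cut by the thin steps. *)
Lemma box_step s (i j : nat) :
  box_ok A B C s -> size_le i j s ->
  settled_in A B C s (step_points s) \/
  exists i' j' : nat, (i' + j' < i + j)%N /\
    refined_in A B C s (step_points s) (size_le i' j').
Proof.
move=> ok [sx sy].
have hx : bx0 s <= bx1 s by case: ok.
have hy : by0 s <= by1 s by case: ok => _ [].
have mx := midpointP hx; have my := midpointP hy.
set l := step_points s.
have wrap l' (P : box -> Prop) i' j' : List.incl l' l -> (i' + j' < i + j)%N ->
    (forall s', subbox s' s -> P s' -> size_le i' j' s') ->
    settled_in A B C s l' \/ refined_in A B C s l' P ->
    settled_in A B C s l \/
  exists i' j' : nat, (i' + j' < i + j)%N /\ refined_in A B C s l (size_le i' j').
  move=> hi hij hP [h|h]; [left; exact: settled_in_incl h|right].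
  by exists i', j'; split=> //; apply: refined_in_incl h.
have p0 : List.incl (probes s (midpoint (bx0 s) (bx1 s)) (midpoint (by0 s) (by1 s))) l.
  exact: incl_appl (incl_refl _).
have py : List.incl (probes s (bx0 s) (midpoint (by0 s) (by1 s)) ++
                probes s (bx1 s) (midpoint (by0 s) (by1 s)))%list l.
  by apply: incl_appr; rewrite List.app_assoc; apply: incl_appl (incl_refl _).
have px : List.incl (probes s (midpoint (bx0 s) (bx1 s)) (by0 s) ++
                probes s (midpoint (bx0 s) (bx1 s)) (by1 s))%list l.
  by do 3 apply: incl_appr; exact: incl_refl.
have cy i' j' : i' = i -> j = j'.+1 -> forall s', subbox s' s ->
    ycut (midpoint (by0 s) (by1 s)) s' -> size_le i' j' s'.
  move=> -> e s' [h1 [h2 [h3 h4]]] h; split; first by lia.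
  by apply: (half_le h3 h4); rewrite -?e //.
have cx i' j' : i = i'.+1 -> j' = j -> forall s', subbox s' s ->
    xcut (midpoint (bx0 s) (bx1 s)) s' -> size_le i' j' s'.
  move=> e -> s' [h1 [h2 [h3 h4]]] h; split; last by lia.
  by apply: (half_le h1 h2); rewrite -?e //.
case: i j => [|i] [|j] in sx sy wrap cx cy *.
- left; case: s ok sx sy @l {wrap hx hy mx my p0 py px cx cy} => a1 a2 b1 b2 w1 w2 u1 u2 /= ok sx sy.
  apply: settled_in_incl (small_box_settled mA mB mC ok _ _); [|lia..].
  by move=> p; rewrite /step_points /probes /=; tauto.
- apply: (wrap _ _ 0%nat j py _ (cy _ _ _ _) (thin_ystep mA mB mC ok my _)) => //; lia.
- apply: (wrap _ _ i 0%nat px _ (cx _ _ _ _) (thin_xstep ok mx _)) => //; lia.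
set x := midpoint (bx0 s) (bx1 s) in p0 mx cx *.
set y := midpoint (by0 s) (by1 s) in p0 my cy *.
have dy : (i.+1 + j < i.+1 + j.+1)%N by rewrite ltn_add2l.
have dx : (i + j.+1 < i.+1 + j.+1)%N by rewrite ltn_add2r.
have wy P := @wrap _ P i.+1 j p0 dy.
have wx P := @wrap _ P i j.+1 p0 dx.
have [Aq|Aq] : x <= A x y \/ A x y <= x by lia.
- have [Bq|Bq] : y <= B x y \/ B x y <= y by lia.
    apply: (wy _ _ (ystep_up mA mB mC ok mx my Aq Bq)).
    by move=> s' hs [h _]; apply: cy.
  have [Cq|Cq] : 0 <= C x y \/ C x y <= 0 by lia.
    apply: (wy _ _ (ystep_right_up mA mB mC ok mx my Aq Bq Cq)).
    by move=> s' hs h; apply: cy.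
  apply: (wx _ _ (xstep_right_down ok mx my Aq Bq Cq)).
  by move=> s' hs h; apply: cx.
- have [Bq|Bq] : y <= B x y \/ B x y <= y by lia.
    have [Cq|Cq] : 0 <= C x y \/ C x y <= 0 by lia.
      apply: (wx _ _ (xstep_left_up ok mx my Aq Bq Cq)).
      by move=> s' hs h; apply: cx.
    apply: (wy _ _ (ystep_left_down mA mB mC ok mx my Aq Bq Cq)).
    by move=> s' hs h; apply: cy.
  apply: (wy _ _ (ystep_down mA mB mC ok mx my Aq Bq)).
  by move=> s' hs [h _]; apply: cy.
Qed.
End Swapped.
End Planar.

(** The extra query is the check of the output made by [guard]. *)
Lemma tarski_of_finds (k : nat) (m : 'I_k -> nat) q : (forall i, 0 < m i) ->
  finds q (@lattice_monotone k m) (fun f x => f x = x) ->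
  exists2 t : tarski_algorithm m, solves_tarski t & worst_case_queries t <= q.+1.
Proof.
move=> m_gt0 [t ht].
have gP f : is_solution f (run (guard m_gt0 t [::]) f) /\
            num_queries (guard m_gt0 t [::]) f <= q.+1.
  by apply: guardP => // g gm _; exact: ht.
exists (guard m_gt0 t [::]) => [f|]; first by have [] := gP f.
by apply/bigmax_leqP => f _; have [] := gP f.
Qed.

(** * Search on a slice with a constant number of queries per halving *)

Section SliceSearch.
Local Open Scope Z_scope.
Variables (X Y : Type) (e : Z -> Z -> X) (al be ga : Y -> Z) (H : (X -> Y) -> Prop).
Let val (g : Y -> Z) (f : X -> Y) (x y : Z) : Z := g (f (e x y)).
Hypotheses (H_al : forall f, H f -> monoZ2 (val al f)) (H_be : forall f, H f -> monoZ2 (val be f))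
           (H_ga : forall f, H f -> monoZ2 (val ga f)).

Lemma box_ok_local A B C A' B' C' s :
  (forall p, In p (corners s) ->
     A p.1 p.2 = A' p.1 p.2 /\ B p.1 p.2 = B' p.1 p.2 /\ C p.1 p.2 = C' p.1 p.2) ->
  box_ok A B C s -> box_ok A' B' C' s.
Proof.
case: s => a1 a2 b1 b2 w1 w2 u1 u2 h; rewrite /box_ok /top_ok /bot_ok /=.
have /= := h (a1, a2); have /= := h (b1, b2); have /= := h (w1, w2); have /= := h (u1, u2).
move=> [|-> [-> ->]]; first tauto.
move=> [|-> [-> ->]]; first tauto.
move=> [|-> [-> ->]]; first tauto.
by move=> [|-> [-> ->]]; first tauto.
Qed.

Lemma slice_search (i j : nat) s : size_le i j s ->
  finds (45 * (i + j).+1)%N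
    (fun f => H f /\ box_ok (val al f) (val be f) (val ga f) s)
    (fun f p => settled (val al f) (val be f) (val ga f) p.1 p.2 /\
       bx0 s <= p.1 <= bx1 s /\ by0 s <= p.2 <= by1 s).
Proof.
have [n le_n] := ubnP (i + j)%N; elim: n => // n IH in i j s le_n *; move=> sz.
pose G f (o : (Z * Z) + box) := match o with
  | inl p => In p (step_points s) /\ settled (val al f) (val be f) (val ga f) p.1 p.2 /\
       bx0 s <= p.1 <= bx1 s /\ by0 s <= p.2 <= by1 s
  | inr s' => box_ok (val al f) (val be f) (val ga f) s' /\ subbox s' s /\
      List.incl (corners s') (step_points s) /\
      exists i' j' : nat, (i' + j' < i + j)%N /\ size_le i' j' s'
  end.
(* [step_points] consists of 5 lists of 9 points, and each step queries all of them in one batch. *)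
have hl : (45 * (i + j).+1 = length (List.map (fun p => e p.1 p.2) (step_points s)) + 45 * (i + j))%N.
  by rewrite List.length_map /= mulnS.
rewrite hl; apply: (finds_bind (G := G)).
  apply: (finds_list (inr s)) => [f [Hf ok]|f g o _ _ fg].
    have [|[i' [j' [lt [s' [h1 [h2 [h3 h4]]]]]]]] := box_step (H_al Hf) (H_be Hf) (H_ga Hf) ok sz.
      by move=> [p1 [p2 h]]; exists (inl (p1, p2)).
    by exists (inr s'); do 3 (split=> //); exists i', j'.
  have {}fg p : In p (step_points s) -> f (e p.1 p.2) = g (e p.1 p.2).
    by move=> hp; apply: fg; exact: (List.in_map (fun p => e p.1 p.2)).
  case: o => [p|s'] /=.
    by move=> [hp]; rewrite /settled /val fg.
  move=> [ok [h2 [h3 h4]]]; split=> //; apply: box_ok_local ok => p /h3 hp.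
  by rewrite /val fg.
case=> [p|s'].
  by apply: (finds_output (a := p)) => f [_ []].
(* These conditions on [s'] do not mention the oracle; when they fail, the outcome [inr s'] never
   arises and any output will do. *)
have [[sb [i' [j' [lt sz']]]]|no] :=
    pselect (subbox s' s /\ exists i' j' : nat, (i' + j' < i + j)%N /\ size_le i' j' s').
  apply: (finds_weaken (h := id)) (IH i' j' s' _ sz').
  - by rewrite leq_mul2l; lia.
  - by move=> f [[Hf _] [ok _]].
  - move=> f p _ [h1 h2]; split=> //; move: sb; rewrite /subbox; lia.
  - lia.
by apply: (finds_output (a := (0, 0))) => f [_ [? [? [? ?]]]]; case: no.
Qed.
End SliceSearch.

(** * Shrinking a box trapped between an upward and a downward moving corner *)

Section Cube.
Local Open Scope Z_scope.
Local Notation pt := (Z * Z * Z)%type.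

Definition le3 (p q : pt) : Prop :=
  p.1.1 <= q.1.1 /\ p.1.2 <= q.1.2 /\ p.2 <= q.2.

Definition mono3 (F : pt -> pt) : Prop := forall p q, le3 p q -> le3 (F p) (F q).

Definition traps (a b : pt) (F : pt -> pt) : Prop :=
  mono3 F /\ le3 a (F a) /\ le3 (F b) b.

Lemma le3_refl p : le3 p p. Proof. by rewrite /le3; lia. Qed.
Lemma le3_trans q p r : le3 p q -> le3 q r -> le3 p r.
Proof. by rewrite /le3; lia. Qed.

(** The two extreme corners of the middle slice are queried first. If one of them can replace [a] or
    [b], the box is halved at once. Otherwise the third coordinate moves down at the lower corner
    and up at the upper one, which makes the slice a valid box for the planar search. The 3 counts
    these two queries and one more that reveals the direction at the settled point. *)
Lemma finds_halving a b (i j k : nat) : le3 a b ->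
  b.1.1 - a.1.1 <= 2 ^ Z.of_nat i -> b.1.2 - a.1.2 <= 2 ^ Z.of_nat j ->
  b.2 - a.2 <= 2 ^ Z.of_nat k.+1 ->
  finds (45 * (i + j).+1 + 3)%N (traps a b)
    (fun F ab => traps ab.1 ab.2 F /\ le3 a ab.1 /\ le3 ab.1 ab.2 /\ le3 ab.2 b /\
       ab.2.2 - ab.1.2 <= 2 ^ Z.of_nat k).
Proof.
move: a b => [[a1 a2] a3] [[b1 b2] b3] ab si sj sk.
set a := (a1, a2, a3) in ab *; set b := (b1, b2, b3) in ab *.
have hz : a3 <= midpoint a3 b3 <= b3 by apply: midpointP; case: ab => _ [].
set z := midpoint a3 b3 in hz.
have half c d : a3 <= c -> d <= b3 -> c = z \/ d = z -> d - c <= 2 ^ Z.of_nat k.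
  by move=> h1 h2 h3; apply: half_le h3.
have [/= h1 [h2 h3]] := ab; rewrite /= in si sj sk.
rewrite addnC !addSn add0n.
apply: (finds_query (x := (a1, a2, z))) => va; apply: (finds_query (x := (b1, b2, z))) => vb.
have [Ca|Ca] : z <= va.2 \/ va.2 < z by lia.
  apply: (finds_output (a := ((a1, a2, z), b))) => F [[[Fm [Fa Fb]] Fva] _].
  have Faz : le3 (F a) (F (a1, a2, z)) by apply: Fm; rewrite /le3 /=; lia.
  rewrite Fva in Faz; split; [split=> //; split=> //|].
    by rewrite Fva; move: Fa Faz; rewrite /le3 /=; lia.
  by split; [|split; [|split]]; rewrite ?/le3 /=; try lia; apply: half; lia.
have [Cb|Cb] : vb.2 <= z \/ z < vb.2 by lia.
  apply: (finds_output (a := (a, (b1, b2, z)))) => F [[[Fm [Fa Fb]] Fva] Fvb].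
  have Faz : le3 (F (b1, b2, z)) (F b) by apply: Fm; rewrite /le3 /=; lia.
  rewrite Fvb in Faz; split; [split=> //; split=> //|].
    by rewrite Fvb; move: Fb Faz; rewrite /le3 /=; lia.
  by split; [|split; [|split]]; rewrite ?/le3 /=; try lia; apply: half; lia.
(* Both corners satisfy the first alternative of [top_ok] and [bot_ok], so the witness fields merely
   repeat them. *)
rewrite -addn1; pose s := Box a1 a2 b1 b2 b1 b2 a1 a2.
have sz : size_le i j s by split.
pose al (v : pt) := v.1.1; pose be (v : pt) := v.1.2; pose ga (v : pt) := v.2 - z.
apply: finds_bind.
  apply: (finds_weaken (h := id) (leqnn _)); last first.
  - apply: (@slice_search _ _ (fun x y => (x, y, z)) al be ga mono3) sz.
    + by move=> F Fm x y x' y' hx hy; have := Fm (x, y, z) (x', y', z); rewrite /le3 /al /be /=; lia.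
    + by move=> F Fm x y x' y' hx hy; have := Fm (x, y, z) (x', y', z); rewrite /le3 /al /be /=; lia.
    + by move=> F Fm x y x' y' hx hy; have := Fm (x, y, z) (x', y', z); rewrite /le3 /ga /=; lia.
  - move=> F p _; exact: id.
  - move=> F [[[Fm [Fa Fb]] Fva] Fvb]; split=> //.
    have : le3 (F a) (F (a1, a2, z)) by apply: Fm; rewrite /le3 /=; lia.
    have : le3 (F (b1, b2, z)) (F b) by apply: Fm; rewrite /le3 /=; lia.
    move: Fa Fb; rewrite /box_ok /top_ok /bot_ok /= /al /be /ga /le3 Fva Fvb /=; lia.
move=> [p1 p2]; rewrite /settled /al /be /ga /=.
apply: (finds_query (x := (p1, p2, z))) => v.
have [hv|hv] := pselect (le3 (p1, p2, z) v).
  apply: (finds_output (a := ((p1, p2, z), b))).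
  move=> F [[[[[Fm [Fa Fb]] _] _] hp] Fp]; rewrite Fp in hp.
  split; [by split=> //; rewrite Fp|].
  by split; [|split; [|split]]; rewrite ?/le3 /=; try lia; apply: half; lia.
apply: (finds_output (a := (a, (p1, p2, z)))).
move=> F [[[[[Fm [Fa Fb]] _] _] hp] Fp]; rewrite Fp in hp.
rewrite /le3 /= in hv.
split; [split=> //; split=> //; rewrite /le3 Fp /=; lia|].
by split; [|split; [|split]]; rewrite ?/le3 /=; try lia; apply: half; lia.
Qed.

Lemma finds_thin a b (i j k : nat) : le3 a b ->
  b.1.1 - a.1.1 <= 2 ^ Z.of_nat i -> b.1.2 - a.1.2 <= 2 ^ Z.of_nat j ->
  b.2 - a.2 <= 2 ^ Z.of_nat k ->
  finds (k * (45 * (i + j).+1 + 3))%N (traps a b)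
    (fun F ab => traps ab.1 ab.2 F /\ le3 a ab.1 /\ le3 ab.1 ab.2 /\ le3 ab.2 b /\
       ab.2.2 - ab.1.2 <= 1).
Proof.
elim: k a b => [|k IH] a b ab si sj sk.
  apply: (finds_output (a := (a, b))) => F h; split=> //; split; first exact: le3_refl.
  by split=> //; split=> //; exact: le3_refl.
rewrite mulSn; apply: finds_bind (finds_halving ab si sj sk) _ => -[a' b'] /=.
have [[h1 [h2 [h3 h4]]]|no] := pselect (le3 a a' /\ le3 a' b' /\ le3 b' b /\
    b'.2 - a'.2 <= 2 ^ Z.of_nat k); last first.
  by apply: (finds_output (a := (a, b))) => F [_ [_ ?]]; case: no.
apply: (finds_weaken (h := id) (leqnn _)); last apply: (IH a' b') => //.
- by move=> F [_ []].
- move=> F ab' _ [g1 [g2 [g3 [g4 g5]]]]; split=> //; split; first exact: le3_trans g2.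
  by split=> //; split=> //; exact: le3_trans h3.
- by move: h1 h2 h3; rewrite /le3; lia.
- by move: h1 h2 h3; rewrite /le3; lia.
Qed.

(** Cyclic rotation of the coordinates carries the thinning of the third coordinate over to the
    other two. *)
Definition rot (p : pt) : pt := (p.1.2, p.2, p.1.1).
Definition unrot (p : pt) : pt := (p.2, p.1.1, p.1.2).

Lemma rotK p : unrot (rot p) = p. Proof. by case: p => -[]. Qed.

Lemma le3_rot p q : le3 (rot p) (rot q) <-> le3 p q.
Proof. by rewrite /le3 /=; lia. Qed.

Lemma le3_unrot p q : le3 (unrot p) (unrot q) <-> le3 p q.
Proof. by rewrite /le3 /=; lia. Qed.

Lemma traps_rot a b F : traps a b F <-> traps (rot a) (rot b) (rot \o F \o unrot).
Proof.
rewrite /traps /= !rotK !le3_rot; split=> -[m h]; split=> // p q pq.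
  by rewrite /= le3_rot; apply: m; rewrite le3_unrot.
by rewrite -le3_rot; have := m (rot p) (rot q); rewrite /= !rotK; apply; rewrite le3_rot.
Qed.

Lemma finds_thin_rot a b (i j k : nat) : le3 a b ->
  b.1.1 - a.1.1 <= 2 ^ Z.of_nat i -> b.1.2 - a.1.2 <= 2 ^ Z.of_nat j ->
  b.2 - a.2 <= 2 ^ Z.of_nat k ->
  finds (i * (45 * (j + k).+1 + 3))%N (traps a b)
    (fun F ab => traps ab.1 ab.2 F /\ le3 a ab.1 /\ le3 ab.1 ab.2 /\ le3 ab.2 b /\
       ab.2.1.1 - ab.1.1.1 <= 1).
Proof.
move=> ab si sj sk.
have := @finds_thin (rot a) (rot b) j k i; rewrite le3_rot /= => /(_ ab sj sk si).
move=> /(finds_translate unrot rot).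
apply: (finds_weaken (h := fun cd => (unrot cd.1, unrot cd.2))) => //.
  by move=> F /traps_rot.
move=> F [c d] _ /= [h1 [h2 [h3 [h4 h5]]]].
have rc p : rot (unrot p) = p by case: p => -[].
split; first by apply/traps_rot; rewrite !rc.
by rewrite -(rc c) -(rc d) !le3_rot in h2 h3 h4.
Qed.

Lemma finds_thin_rot2 a b (i j k : nat) : le3 a b ->
  b.1.1 - a.1.1 <= 2 ^ Z.of_nat i -> b.1.2 - a.1.2 <= 2 ^ Z.of_nat j ->
  b.2 - a.2 <= 2 ^ Z.of_nat k ->
  finds (j * (45 * (k + i).+1 + 3))%N (traps a b)
    (fun F ab => traps ab.1 ab.2 F /\ le3 a ab.1 /\ le3 ab.1 ab.2 /\ le3 ab.2 b /\
       ab.2.1.2 - ab.1.1.2 <= 1).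
Proof.
move=> ab si sj sk.
have := @finds_thin_rot (rot a) (rot b) j k i; rewrite le3_rot /= => /(_ ab sj sk si).
move=> /(finds_translate unrot rot).
apply: (finds_weaken (h := fun cd => (unrot cd.1, unrot cd.2))) => //.
  by move=> F /traps_rot.
move=> F [c d] _ /= [h1 [h2 [h3 [h4 h5]]]].
have rc p : rot (unrot p) = p by case: p => -[].
split; first by apply/traps_rot; rewrite !rc.
by rewrite -(rc c) -(rc d) !le3_rot in h2 h3 h4.
Qed.

Definition sum3 (p : pt) : Z := p.1.1 + p.1.2 + p.2.

(** Iteration from [a] stays below [b], and every application that changes the point raises the
    coordinate sum by at least 1. *)
Lemma finds_iterate (n : nat) a b : le3 a b -> sum3 b - sum3 a <= Z.of_nat n ->
  finds n.+1 (traps a b) (fun F p => F p = p).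
Proof.
elim: n a => [|n IH] a ab hn; apply: (finds_query (x := a)) => v.
  apply: (finds_output (a := a)) => F [[Fm [Fa Fb]] Fv].
  have := le3_trans (Fm _ _ ab) Fb; move: Fa {Fm Fb Fv}.
  move: (F a) => c; case: c a b ab hn => [[? ?] ?] [[? ?] ?] [[? ?] ?]; rewrite /sum3 /le3 /=.
  by move=> *; do 2?[congr pair]; lia.
have [av|nav] := pselect (le3 a v /\ le3 v b); last first.
  apply: (finds_output (a := a)) => F [[Fm [Fa Fb]] Fv]; case: nav; rewrite -Fv; split=> //.
  exact: le3_trans (Fm _ _ ab) Fb.
have [e|ne] := pselect (v = a).
  by apply: (finds_output (a := a)) => F [_ ->].
apply: (finds_weaken (h := id) (leqnn _)); last apply: (IH v).
- by move=> F [[Fm [Fa Fb]] Fv]; split=> //; split=> //; rewrite -{1}Fv; apply: Fm; case: av.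
- by [].
- by case: av.
- have [//|h] : sum3 b - sum3 v <= Z.of_nat n \/ sum3 v <= sum3 a by lia.
  case: ne; case: av h {hn ab IH} => + _.
  case: v a => [[? ?] ?] [[? ?] ?]; rewrite /sum3 /le3 /=.
  by move=> *; do 2?[congr pair]; lia.
Qed.

Definition cube_cost (l : nat) : nat :=
  (let c := l * (45 * (l + l).+1 + 3) in c + (c + (c + 4)))%N.

(** One thinning phase per coordinate leaves sides of at most 1, hence a gap of at most 3 between
    coordinate sums, and 4 queries of iteration finish. *)
Lemma finds_cube a b (l : nat) : le3 a b ->
  b.1.1 - a.1.1 <= 2 ^ Z.of_nat l -> b.1.2 - a.1.2 <= 2 ^ Z.of_nat l ->
  b.2 - a.2 <= 2 ^ Z.of_nat l ->
  finds (cube_cost l) (traps a b) (fun F p => F p = p).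
Proof.
move=> ab s1 s2 s3; rewrite /cube_cost.
apply: finds_bind (finds_thin ab s1 s2 s3) _ => -[a' b'] /=.
have [[h1 [h2 [h3 h4]]]|no] := pselect (le3 a a' /\ le3 a' b' /\ le3 b' b /\
    b'.2 - a'.2 <= 1); last first.
  by apply: (finds_output (a := a)) => F [_ [_ ?]]; case: no.
have r1 : b'.1.1 - a'.1.1 <= 2 ^ Z.of_nat l by move: h1 h3; rewrite /le3; lia.
have r2 : b'.1.2 - a'.1.2 <= 2 ^ Z.of_nat l by move: h1 h3; rewrite /le3; lia.
have r3 : b'.2 - a'.2 <= 2 ^ Z.of_nat l by move: h1 h3; rewrite /le3; lia.
apply: (finds_bind (finds_sub (finds_thin_rot h2 r1 r2 r3) _)); first by move=> F [_ []].
move=> [a2 b2] /=.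
have [[g1 [g2 [g3 g4]]]|no] := pselect (le3 a' a2 /\ le3 a2 b2 /\ le3 b2 b' /\
    b2.1.1 - a2.1.1 <= 1); last first.
  by apply: (finds_output (a := a)) => F [_ [_ ?]]; case: no.
have q1 : b2.1.1 - a2.1.1 <= 2 ^ Z.of_nat l by move: g1 g3; rewrite /le3; lia.
have q2 : b2.1.2 - a2.1.2 <= 2 ^ Z.of_nat l by move: g1 g3; rewrite /le3; lia.
have q3 : b2.2 - a2.2 <= 2 ^ Z.of_nat l by move: g1 g3; rewrite /le3; lia.
apply: (finds_bind (finds_sub (finds_thin_rot2 g2 q1 q2 q3) _)); first by move=> F [_ []].
move=> [a3 b3] /=.
have [[k1 [k2 [k3 k4]]]|no] := pselect (le3 a2 a3 /\ le3 a3 b3 /\ le3 b3 b2 /\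
    b3.1.2 - a3.1.2 <= 1); last first.
  by apply: (finds_output (a := a)) => F [_ [_ ?]]; case: no.
have hs : sum3 b3 - sum3 a3 <= Z.of_nat 3 by move: g1 g3 k1 k3; rewrite /sum3 /le3; lia.
by apply: (finds_sub (finds_iterate k2 hs)) => F [_ []].
Qed.
End Cube.

(** * The upper bound on three-dimensional lattices *)

Section UpperBound.
Variables (m : 'I_3 -> nat).
Hypothesis m_gt0 : forall i, 0 < m i.
Local Notation L := (lattice m).
Let i0 : 'I_3 := inord 0.
Let i1 : 'I_3 := inord 1.
Let i2 : 'I_3 := inord 2.

Let ord3 (i : 'I_3) : [\/ i = i0, i = i1 | i = i2].
Proof.
case: i => -[|[|[|//]]] h; [apply: Or31|apply: Or32|apply: Or33];
  by apply: val_inj; rewrite /= inordK.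
Qed.

(** Clamping makes this map total, so that an oracle on the lattice becomes a function on all
    integer triples. *)
Let of_triple (p : Z * Z * Z) : L :=
  clamp_point m_gt0 (fun i => Z.to_nat (if i == i0 then p.1.1 else if i == i1 then p.1.2 else p.2)).

Let to_triple (x : L) : Z * Z * Z :=
  (Z.of_nat (coord x i0), Z.of_nat (coord x i1), Z.of_nat (coord x i2)).

Let i10 : (i1 == i0) = false. Proof. by apply/eqP => /(congr1 val); rewrite /= !inordK. Qed.
Let i20 : (i2 == i0) = false. Proof. by apply/eqP => /(congr1 val); rewrite /= !inordK. Qed.
Let i21 : (i2 == i1) = false. Proof. by apply/eqP => /(congr1 val); rewrite /= !inordK. Qed.

Let to_tripleK x : of_triple (to_triple x) = x.
Proof.
apply: coord_inj => i; rewrite coord_clamp_point /=; have := coord_bounds x i.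
by case: (ord3 i) => ->; rewrite ?i10 ?i20 ?i21 ?eqxx Nat2Z.id /clamp; lia.
Qed.

Let of_triple_mono p q : le3 p q -> lattice_le (of_triple p) (of_triple q).
Proof.
move=> [h1 [h2 h3]]; apply/forallP => i; rewrite !coord_clamp_point /clamp.
by case: (ord3 i) => ->; rewrite ?i10 ?i20 ?i21 ?eqxx; lia.
Qed.

Let to_triple_mono x y : lattice_le x y -> le3 (to_triple x) (to_triple y).
Proof. by move=> /forallP h; have := h i0; have := h i1; have := h i2; rewrite /le3 /=; lia. Qed.

Lemma finds_fixpoint (l : nat) : width m <= 2 ^ l ->
  finds (cube_cost l) (@lattice_monotone 3 m) (fun f x => f x = x).
Proof.
move=> hl.
have ml i : Z.le (Z.of_nat (m i)) (2 ^ Z.of_nat l).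
  have : m i <= 2 ^ l by apply: leq_trans hl; exact: leq_bigmax.
  have -> : Z.pow 2 (Z.of_nat l) = Z.of_nat (2 ^ l).
    by elim: l {hl} => // l IH; rewrite Nat2Z.inj_succ Z.pow_succ_r ?IH ?expnS; lia.
  by lia.
pose a : Z * Z * Z := (Z.of_nat 1, Z.of_nat 1, Z.of_nat 1).
pose b : Z * Z * Z := (Z.of_nat (m i0), Z.of_nat (m i1), Z.of_nat (m i2)).
have g0 := m_gt0 i0; have g1 := m_gt0 i1; have g2 := m_gt0 i2.
have l0 := ml i0; have l1 := ml i1; have l2 := ml i2.
have ab : le3 a b by rewrite /le3 /=; lia.
have := finds_translate of_triple to_triple (@finds_cube a b l ab _ _ _) => /=.
have lt (i : 'I_3) : Z.le (Z.of_nat (m i) - Z.of_nat 1) (2 ^ Z.of_nat l) by have := ml i; lia.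
move=> /(_ (lt _) (lt _) (lt _)).
apply: (finds_weaken (h := of_triple)) => //.
- move=> f fm; split; first by move=> p q /of_triple_mono/fm/to_triple_mono.
  have bd (x : L) i := coord_bounds x i.
  split; rewrite /le3 /=.
    have := bd (f (of_triple a)) i0; have := bd (f (of_triple a)) i1.
    have := bd (f (of_triple a)) i2; lia.
  have := bd (f (of_triple b)) i0; have := bd (f (of_triple b)) i1.
  have := bd (f (of_triple b)) i2; lia.
- by move=> f p _ /= e; rewrite -{2}e to_tripleK.
Qed.

Lemma query_complexity_upper (l : nat) : width m <= 2 ^ l ->
  query_complexity m <= (cube_cost l).+1.
Proof.
move=> /finds_fixpoint/(tarski_of_finds m_gt0)[t ts tq].
by apply: leq_trans tq; have [_] := query_complexityP m_gt0; apply.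
Qed.
End UpperBound.

(** * The herringbone function along a staircase *)

Section Herringbone.
Variables (lo : nat -> nat) (t : nat).
Hypothesis lo_mono : forall y y', y <= y' -> lo y <= lo y'.

(** In row [y] the staircase runs from [lo y] to [lo y.+1]. Points left of it step right and down,
    points right of it step left and up, and points on it step along it towards the antidiagonal
    [x + y = t]. *)
Definition herringbone (x y : nat) : nat * nat :=
  if x < lo y then (x.+1, y.-1)
  else if lo y.+1 < x then (x.-1, y.+1)
  else if x + y < t then (if x < lo y.+1 then (x.+1, y) else (x, y.+1))
  else if t < x + y then (if lo y < x then (x.-1, y) else (x, y.-1))
  else (x, y).

Lemma herringbone_mono x y x' y' : x <= x' -> y <= y' ->
  (herringbone x y).1 <= (herringbone x' y').1 /\
  (herringbone x y).2 <= (herringbone x' y').2.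
Proof.
move=> hx hy; have l1 := lo_mono hy; have l2 : lo y.+1 <= lo y'.+1 by exact: lo_mono.
have [e|lt] : y = y' \/ y < y' by lia.
  subst y'; have l0 : lo y <= lo y.+1 by exact: lo_mono.
  by rewrite /herringbone; do !case: ifP => /=; lia.
have l3 := lo_mono lt; have l0 : lo y <= lo y.+1 by exact: lo_mono.
have l4 : lo y' <= lo y'.+1 by exact: lo_mono.
(* A step changes the row by at most 1, so adjacent rows are the delicate case. *)
have [e|lt2] : y' = y.+1 \/ y.+1 < y' by lia.
  by subst y'; rewrite /herringbone; do !case: ifP => /=; lia.
by rewrite /herringbone; do !case: ifP => /=; lia.
Qed.

(** The minimum with [N] accounts for clamping to a finite grid. It creates no spurious fixed point,
    because the staircase starts inside the grid and its point [(cx, cy)] on the antidiagonal lies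
    there too. *)
Lemma herringbone_fixed N cx cy x y :
  lo cy <= cx <= lo cy.+1 -> cx + cy = t -> lo 0 <= N -> cx <= N -> cy <= N ->
  x <= N -> y <= N ->
  minn N (herringbone x y).1 = x -> minn N (herringbone x y).2 = y -> x + y = t.
Proof.
move=> hc ht h0 hcx hcy hx hy.
have l0 : lo y <= lo y.+1 by exact: lo_mono.
have l1 : y < cy -> lo y.+1 <= lo cy by exact: lo_mono.
have l2 : cy <= y -> lo cy.+1 <= lo y.+1 by move=> h; exact: lo_mono.
have l3 : lo 0 <= lo cy by exact: lo_mono.
have l4 : y = 0 -> lo y = lo 0 by move=> ->.
rewrite /herringbone; do !case: ifP => /=; lia.
Qed.
End Herringbone.

(** * Staircases with one vertical and one horizontal part per block *)

Section Staircase.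
Variables (w : nat) (u : nat -> nat).
Hypothesis w_gt0 : 0 < w.
Hypothesis u_block : forall k, k./2 * w <= u k < k./2 * w + w.

(* The staircase has its vertical parts at abscissas u 0, u 2, ... and its
   horizontal parts at ordinates u 1, u 3, ...; it meets row y between
   abscissas stair y and stair y.+1. *)
Definition stair (y : nat) : nat :=
  let j := y %/ w in if y <= u j.*2.+1 then u j.*2 else u j.+1.*2.

Lemma block_even j : j * w <= u j.*2 < j * w + w.
Proof. by have := u_block j.*2; rewrite doubleK. Qed.

Lemma block_odd j : j * w <= u j.*2.+1 < j * w + w.
Proof. by have := u_block j.*2.+1; rewrite /= uphalf_double. Qed.

Lemma block_coord y : y %/ w * w <= y < y %/ w * w + w.
Proof. by rewrite leq_divM -mulSnr ltn_ceil. Qed.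

(** If row [y.+1] opens a new block, then [y] is the last row of its own block, hence not below the
    horizontal part there, and both sides are [u j.+1.*2]. *)
Lemma stairS y : stair y.+1 =
  let j := y %/ w in if y < u j.*2.+1 then u j.*2 else u j.+1.*2.
Proof.
rewrite /stair /=; have := block_coord y; have := block_coord y.+1.
have := leq_div2r w (leqnSn y); set j := y %/ w; set j' := y.+1 %/ w => jj h' h.
have [e|lt] : j' = j \/ j < j' by lia.
  by rewrite e.
have le : j.+1 * w <= j' * w by rewrite leq_mul2r lt orbT.
have e : j' = j.+1.
  apply/eqP; rewrite eqn_leq lt andbT.
  have : j' * w < j.+2 * w by rewrite !mulSn; lia.
  by rewrite ltn_mul2r => /andP[].
rewrite e; have := block_odd j; have := block_odd j.+1; rewrite mulSn in le *.
by rewrite e mulSn in h' => *; do !case: ifP; lia.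
Qed.

Lemma even_mono j j' : j <= j' -> u j.*2 <= u j'.*2.
Proof.
rewrite leq_eqVlt => /predU1P[->//|lt].
have : j.+1 * w <= j' * w by rewrite leq_mul2r lt orbT.
by have := block_even j; have := block_even j'; rewrite mulSn; lia.
Qed.

Lemma stair_mono y y' : y <= y' -> stair y <= stair y'.
Proof.
move=> le; have := leq_div2r w le; rewrite /stair /=.
set j := y %/ w; set j' := y' %/ w => jj.
have h1 := @even_mono j j.+1 (leqnSn _); have h2 := @even_mono j' j'.+1 (leqnSn _).
have [e|lt] : j = j' \/ j < j' by lia.
  by rewrite -e in h2 *; do !case: ifP; lia.
have h3 := @even_mono j.+1 j' lt.
by do !case: ifP; lia.
Qed.

(** Parts [k] and [k.+1] meet in corner [k]; the sum of its coordinates is its position along the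
    staircase and serves as [t] in [herringbone]. *)
Definition corner_sum k := u k + u k.+1.

Lemma u_lt_skip k : u k < u k.+2.
Proof. by have := u_block k; have := u_block k.+2; rewrite /= mulSn; lia. Qed.

Lemma corner_sum_mono k k' : k <= k' -> corner_sum k <= corner_sum k'.
Proof.
move=> /subnK <-; elim: (k' - k) => // d IH; apply: leq_trans IH _.
by rewrite addSn /corner_sum; have := u_lt_skip (d + k); lia.
Qed.

Lemma corner_on_stair k : exists cx cy,
  [/\ stair cy <= cx <= stair cy.+1, cx + cy = corner_sum k &
      (cx = u k /\ cy = u k.+1) \/ (cx = u k.+1 /\ cy = u k)].
Proof.
have dv j : u j.*2.+1 %/ w = j.
  have h := block_odd j; have -> : u j.*2.+1 = j * w + (u j.*2.+1 - j * w) by lia.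
  by rewrite divnMDl // divn_small ?addn0 //; lia.
have e j := @even_mono j j.+1 (leqnSn _).
rewrite -[k]odd_double_half; move: (k./2) => j; case: (odd k) => /=.
  exists (u j.+1.*2), (u j.*2.+1); rewrite stairS /stair dv /= leqnn ltnn /corner_sum doubleS.
  by split; [have := e j; rewrite doubleS; lia|rewrite add1n; lia|right].
exists (u j.*2), (u j.*2.+1); rewrite stairS /stair dv /= leqnn ltnn /corner_sum.
by split; [have := e j; rewrite doubleS; lia|rewrite add0n; lia|left].
Qed.

(** Compares [K] with the index of the part that carries a staircase point of row [y]: the vertical
    part [j.*2] below the horizontal part of the block, [j.*2.+1] on it, [j.+1.*2] above it. *)
Definition ahead K y : bool :=
  let j := y %/ w in
  if y < u j.*2.+1 then j.*2 < K
  else if u j.*2.+1 < y then j.+1.*2 < K else j.*2.+1 < K.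

(* Away from the active corners [K, K + M), a point of the staircase lies
   before or after all of them. *)
Lemma stair_ahead K M k x y :
  K <= k < K + M ->
  (forall j, K <= j.*2 < K + M -> u j.*2 <> x) ->
  (K <= (y %/ w).*2.+1 < K + M -> u (y %/ w).*2.+1 <> y) ->
  stair y <= x <= stair y.+1 ->
  (x + y < corner_sum k) = ahead K y /\ (corner_sum k < x + y) = ~~ ahead K y.
Proof.
move=> hk hx hy; rewrite stairS /stair /ahead /=.
have by_ := block_coord y; set j := y %/ w in hy by_ *.
have s k' := u_lt_skip k'.
have be := block_even j; have bo := block_odd j.
have be1 := block_even j.+1; have bo1 := block_odd j.+1; rewrite mulSn in be1 bo1.
have up k' : k' <= k -> corner_sum k' <= corner_sum k by exact: corner_sum_mono.
have dn k' : k <= k' -> corner_sum k <= corner_sum k' by exact: corner_sum_mono.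
have s0 := s j.*2; have s1 := s j.*2.+1; have s2 := s j.*2.+2; have s3 := s j.*2.+3.
have hx0 := hx j; have hx1 := hx j.+1; rewrite doubleS in hx1 be1 bo1 *.
have prev : k < j.*2 -> corner_sum k < j * w + u j.*2.
  case: (j) (block_odd j.-1) dn => [|i] //= bi dn' lt.
  have := dn' i.*2.+1; rewrite /corner_sum doubleS mulSn; rewrite doubleS in lt.
  by lia.
have d0 := dn j.*2; have d1 := dn j.*2.+1; have u1 := up j.*2.+1; have u2 := up j.*2.+2.
have u3 := up j.*2.+3.
rewrite /corner_sum in d0 d1 u1 u2 u3 prev *.
by do !case: ifP; lia.
Qed.
End Staircase.

(** The value at [(x, y)] depends on the side of the staircase the point is on and, for points on
    it, on the side of the target corner. If no active part passes through the point, the latter is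
    the same for all active corners. *)
Lemma herringbone_eq w u u' K M k k' x y :
  0 < w ->
  (forall k, k./2 * w <= u k < k./2 * w + w) ->
  (forall k, k./2 * w <= u' k < k./2 * w + w) ->
  K <= k < K + M -> K <= k' < K + M ->
  (forall j, (x < u j.*2) = (x < u' j.*2) /\ (u j.*2 < x) = (u' j.*2 < x)) ->
  (forall j, K <= j.*2 < K + M -> u j.*2 <> x) ->
  (y < u (y %/ w).*2.+1) = (y < u' (y %/ w).*2.+1) /\
  (u (y %/ w).*2.+1 < y) = (u' (y %/ w).*2.+1 < y) ->
  (K <= (y %/ w).*2.+1 < K + M -> u (y %/ w).*2.+1 <> y) ->
  herringbone (stair w u) (corner_sum u k) x y =
  herringbone (stair w u') (corner_sum u' k') x y.
Proof.
move=> w0 bu bu' hk hk' cx nx [cy1 cy2] ny.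
have nx' j : K <= j.*2 < K + M -> u' j.*2 <> x by move=> /nx; have := cx j; lia.
have ny' : K <= (y %/ w).*2.+1 < K + M -> u' (y %/ w).*2.+1 <> y by move=> /ny; lia.
have A := stair_ahead w0 bu hk nx ny; have A' := stair_ahead w0 bu' hk' nx' ny'.
have e : ahead w u K y = ahead w u' K y by rewrite /ahead /= cy1 cy2.
rewrite -e in A'; move: (ahead w u K y) A A' {e} => d.
have e1 : (x < stair w u y) = (x < stair w u' y) /\ (stair w u y < x) = (stair w u' y < x).
  rewrite /stair /=; have -> : (y <= u (y %/ w).*2.+1) = (y <= u' (y %/ w).*2.+1) by lia.
  by case: ifP => _; apply: cx.
have e2 : (x < stair w u y.+1) = (x < stair w u' y.+1) /\
          (stair w u y.+1 < x) = (stair w u' y.+1 < x).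
  by rewrite !stairS //= cy1; case: ifP => _; apply: cx.
move=> A A'; rewrite /herringbone; case: e1 e2 => [e1 e1'] [e2 e2'].
rewrite e1 e1' e2 e2'; case: ifP => // h1; case: ifP => // h2.
have [-> ->] := A ltac:(lia); by have [-> ->] := A' ltac:(lia).
Qed.

Lemma exp2_gt0 k : 0 < 2 ^ k. Proof. by rewrite expn_gt0. Qed.

(** * The adversary and the lower bound *)

Section Adversary.
Variables (n h : nat) (m : 'I_3 -> nat).
Hypotheses (m_eq : forall i, m i = n) (h_gt0 : 0 < h) (n_ge : 2 ^ (4 * h) <= n).
Local Notation L := (lattice m).
Let w := 2 ^ (2 * h).
Let i0 : 'I_3 := inord 0.
Let i1 : 'I_3 := inord 1.

Let n_gt0 : 0 < n. Proof. by apply: leq_trans n_ge; rewrite expn_gt0. Qed.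
Let w_gt0 : 0 < w. Proof. by rewrite expn_gt0. Qed.
Let w_ge2 : 2 <= 2 ^ (2 * h).
Proof. by rewrite (@leq_exp2l 2 1) // muln_gt0. Qed.
Let m_gt0 i : 0 < m i. Proof. by rewrite m_eq. Qed.

(** The shifts by 1 pass between lattice coordinates, which start at 1, and planar ones, which start
    at 0; the third coordinate is always sent to 1. *)
Definition hard (u : nat -> nat) (k : nat) (z : L) : L :=
  let v := herringbone (stair w u) (corner_sum u k) (coord z i0).-1 (coord z i1).-1 in
  clamp_point m_gt0 (fun i => if i == i0 then v.1.+1 else if i == i1 then v.2.+1 else 1).

Let blocks (u : nat -> nat) := forall k, k./2 * w <= u k < k./2 * w + w.

Lemma hard_monotone u k : blocks u -> lattice_monotone (hard u k).
Proof.
move=> bu x y /forallP xy; apply/forallP => i; rewrite !coord_clamp_point /clamp.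
have [] := @herringbone_mono (stair w u) (corner_sum u k) (stair_mono w_gt0 bu)
  (coord x i0).-1 (coord x i1).-1 (coord y i0).-1 (coord y i1).-1.
- by have := xy i0; lia.
- by have := xy i1; lia.
by case: ifP => _; [|case: ifP => _]; lia.
Qed.

Let i10 : (i1 == i0) = false. Proof. by apply/eqP => /(congr1 val); rewrite /= !inordK. Qed.

Lemma u_small u k : blocks u -> k <= 2 ^ (2 * h) -> u k < n.
Proof.
move=> bu hk; apply: leq_trans n_ge.
have -> : 2 ^ (4 * h) = 2 ^ (2 * h) * w by rewrite /w -expnD; congr (2 ^ _)%N; lia.
have /andP[_ hu] := bu k; apply: leq_trans hu _.
have : k./2.+1 * w <= 2 ^ (2 * h) * w; last by rewrite mulSn addnC.
rewrite leq_mul2r; apply/orP; right.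
have := w_ge2.
by lia.
Qed.

Lemma hard_fixed u k z : blocks u -> k < 2 ^ (2 * h) -> hard u k z = z ->
  (coord z i0).-1 + (coord z i1).-1 = corner_sum u k.
Proof.
move=> bu hk e.
have [cx [cy [h1 h2 h3]]] := corner_on_stair w_gt0 bu k.
have c0 := u_small bu (ltnW hk); have c1 := u_small bu hk.
have b0 := coord_bounds z i0; have b1 := coord_bounds z i1; rewrite !m_eq in b0 b1.
have p2 := w_ge2.
have l0 : stair w u 0 < n.
  by rewrite /stair div0n /=; apply: u_small.
move: (congr1 (fun z => coord z i0) e) (congr1 (fun z => coord z i1) e).
rewrite !coord_clamp_point !m_eq eqxx i10 eqxx /clamp => e0 e1.
by apply: (herringbone_fixed (stair_mono w_gt0 bu) (N := n.-1) h1 h2); lia.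
Qed.

(* The adversary knows p k <= u k < p k + 2 ^ a k for every k, and that the fixed
   corner has index in [K, K + 2 ^ r). *)
Definition member (p a : nat -> nat) (u : nat -> nat) : Prop :=
  forall k, p k <= u k < p k + 2 ^ a k.

(** Counts the halvings spent on active intervals, whose initial length is [2 ^ (2 * h)]. *)
Definition potential (a : nat -> nat) (K r : nat) : nat :=
  \sum_(K <= k < K + 2 ^ r) (2 * h - a k).

Definition state_ok (p a : nat -> nat) (K r : nat) : Prop :=
  [/\ forall k, k./2 * w <= p k /\ p k + 2 ^ a k <= k./2 * w + w,
      forall k, ~~ (K <= k < K + 2 ^ r) -> a k = 0 &
      K + 2 ^ r <= 2 ^ (2 * h)].

Definition decided (p a : nat -> nat) (K r e x : nat) : Prop :=
  (forall u u', member p a u -> member p a u' ->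
     (x < u e) = (x < u' e) /\ (u e < x) = (u' e < x)) /\
  (K <= e < K + 2 ^ r -> forall u, member p a u -> u e <> x).

Lemma member_blocks p a K r u : state_ok p a K r -> member p a u -> blocks u.
Proof. by move=> [h1 _ _] h2 k; have := h1 k; have := h2 k; lia. Qed.

Lemma member_low p a : member p a p.
Proof. by move=> k; have := exp2_gt0 (a k); lia. Qed.

(** Of the interval of part [e] the half that avoids [x] is kept, at the price of one unit of
    potential. An inactive part is already known exactly. *)
Lemma shrink p a K r e x : state_ok p a K r -> (K <= e < K + 2 ^ r -> 0 < a e) ->
  exists p' a', [/\ state_ok p' a' K r, forall u, member p' a' u -> member p a u,
    decided p' a' K r e x, potential a' K r <= (potential a K r).+1 &
    forall k, k <> e -> a' k = a k].
Proof.
move=> ok ae; have [/ae a0|inact] := boolP (K <= e < K + 2 ^ r); last first.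
  exists p, a; split=> //; split=> [u u' hu hu'|]; last by rewrite (negbTE inact).
  have [_ fr _] := ok; have := hu e; have := hu' e; rewrite (fr e inact) expn0.
  by move=> h1 h2; have -> : u e = u' e by lia.
pose a' k := if k == e then (a e).-1 else a k.
pose p' k := if (k == e) && (x < p e + 2 ^ (a e).-1) then p e + 2 ^ (a e).-1 else p k.
have pw : 2 ^ a e = 2 ^ (a e).-1 + 2 ^ (a e).-1 by rewrite -{1}(prednK a0) expnS mul2n addnn.
have hp k : p k <= p' k /\ p' k + 2 ^ a' k <= p k + 2 ^ a k.
  rewrite /p' /a'; have [->|] := eqVneq k e; last by rewrite /=; lia.
  by rewrite pw /=; case: ifP; lia.
have [bl fr top] := ok.
exists p', a'; split.
- split=> // k; first by have := bl k; have := hp k; lia.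
  by move=> hk; rewrite /a'; have [ke|_] := eqVneq k e; rewrite ?fr // -?ke ?fr.
- by move=> u hu k; have := hu k; have := hp k; lia.
- have out u : member p' a' u -> (x < p e + 2 ^ (a e).-1 -> x < u e) /\
      (p e + 2 ^ (a e).-1 <= x -> u e < x).
    by move=> hu; have := hu e; rewrite /p' /a' eqxx /=; case: ifP; lia.
  split=> [u u' /out h1 /out h2|_ u /out]; lia.
- rewrite /potential.
  apply: (@leq_trans (\sum_(K <= k < K + 2 ^ r) ((2 * h - a k) + (k == e)))).
    by apply: leq_sum => k _; rewrite /a'; have [->|] := eqVneq k e; lia.
  rewrite big_split /= -[X in _ <= X]addn1 leq_add2l.
  rewrite -big_mkcond /= sum1_count count_uniq_mem ?iota_uniq //.
  by case: (_ \in _).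
- by move=> k /eqP ke; rewrite /a' (negbTE ke).
Qed.

Lemma decided_sub p a p' a' K r e x :
  (forall u, member p' a' u -> member p a u) -> decided p a K r e x -> decided p' a' K r e x.
Proof.
move=> sub [h1 h2]; split=> [u u' /sub hu /sub hu'|act u /sub]; first exact: h1.
exact: h2.
Qed.

Lemma div_block j x y : j * w <= y < j * w + w -> x %/ w <> j ->
  (x < y) = (x %/ w < j) /\ (y < x) = (j < x %/ w).
Proof.
move=> hy ne; have hx := block_coord w_gt0 x; move: (x %/ w) ne hx => i ne hx.
have [lt|lt] : i < j \/ j < i by lia.
  have : i.+1 * w <= j * w by rewrite leq_mul2r lt orbT.
  by rewrite mulSn; lia.
have : j.+1 * w <= i * w by rewrite leq_mul2r lt orbT.
by rewrite mulSn; lia.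
Qed.

(** Parts of other blocks compare with a coordinate by block number alone, so only the vertical part
    in the block of [x] and the horizontal part in the block of [y] have to be decided. *)
Lemma hard_eq p a K r u u' k k' z : state_ok p a K r ->
  member p a u -> member p a u' -> K <= k < K + 2 ^ r -> K <= k' < K + 2 ^ r ->
  decided p a K r ((coord z i0).-1 %/ w).*2 (coord z i0).-1 ->
  decided p a K r ((coord z i1).-1 %/ w).*2.+1 (coord z i1).-1 ->
  hard u k z = hard u' k' z.
Proof.
move=> ok hu hu' hk hk'; set x := (coord z i0).-1; set y := (coord z i1).-1.
move=> [dx1 dx2] [dy1 dy2].
have bu := member_blocks ok hu; have bu' := member_blocks ok hu'.
rewrite /hard -/x -/y.
suff -> : herringbone (stair w u) (corner_sum u k) x y =
          herringbone (stair w u') (corner_sum u' k') x y by [].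
apply: (herringbone_eq w_gt0 bu bu' hk hk').
- move=> j; have [e|/eqP ne] := eqVneq (x %/ w) j; first by rewrite -e; exact: dx1.
  have [-> ->] := div_block (block_even bu j) ne.
  by have [-> ->] := div_block (block_even bu' j) ne.
- move=> j act; have [e|/eqP ne] := eqVneq (x %/ w) j.
    by rewrite -e in act *; exact: dx2.
  by have := div_block (block_even bu j) ne; lia.
- exact: dy1.
- by move=> act; exact: dy2.
Qed.

(* While the potential is small every active interval can still be halved; once
   it is large, the half of the corners with the smaller potential is kept. *)
Lemma adversary (T : tarski_algorithm m) (N r K : nat) (p a : nat -> nat) :
  state_ok p a K r ->
  (forall u k, member p a u -> K <= k < K + 2 ^ r ->
     is_solution (hard u k) (run T (hard u k)) /\ num_queries T (hard u k) <= N) ->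
  r * h <= 2 * N + potential a K r.
Proof.
elim: T N r K p a => [ans|z next IH] N r K p a ok hT.
  (* With at least two corners left, an output fixed point would have to fit both [K] and [K.+1],
     whose corner sums differ; a violation is excluded by monotonicity. *)
  case: r => [//|r] in ok hT *.
  have p2 : 2 <= 2 ^ r.+1 by rewrite expnS; have := exp2_gt0 r; lia.
  have bp := member_blocks ok (member_low p a).
  have [s0 _] := hT p K (member_low p a) ltac:(lia).
  have [s1 _] := hT p K.+1 (member_low p a) ltac:(lia).
  have [_ _ top] := ok.
  case: ans s0 s1 {hT} => [x|x y] /= s0 s1.
    have f0 := hard_fixed bp (_ : K < _) s0; have f1 := hard_fixed bp (_ : K.+1 < _) s1.
    have := u_lt_skip w_gt0 bp K; move: f0 f1; rewrite /corner_sum.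
    by move=> /(_ ltac:(lia)) + /(_ ltac:(lia)); lia.
  by case: s0 => le; case; exact: hard_monotone.
elim: r K p a ok hT => [//|r IHr] K p a ok hT.
have bigN : 0 < N.
  have [_] := hT p K (member_low p a) ltac:(have := exp2_gt0 (r.+1); lia).
  by move=> /=; lia.
have e2 : 2 ^ r.+1 = 2 ^ r + 2 ^ r by rewrite expnS mul2n addnn.
have [bl fr top] := ok.
(* Adding the bounds for both halves gives [2 * r * h <= 4 * N] plus the potential. When the
   potential is at least [2 * h - 1], this yields the claim for [r.+1], the missing unit being
   recovered by parity. *)
have [big|small] := leqP (2 * h).-1 (potential a K r.+1).
  have split_pot : potential a K r.+1 = potential a K r + potential a (K + 2 ^ r) r.
    by rewrite /potential e2 addnA (@big_cat_nat _ _ _ (K + 2 ^ r)) //= ?leq_addr.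
  (* Parts outside the kept range get exponent 0, which fixes them at [p k]. No query is consumed:
     the induction on [r] applies to the same tree. *)
  have freeze K' : K <= K' -> K' + 2 ^ r <= K + 2 ^ r.+1 ->
      r * h <= 2 * N + potential a K' r.
    move=> h1 h2; pose a' k := if K' <= k < K' + 2 ^ r then a k else 0.
    have a'a k : 0 < 2 ^ a' k <= 2 ^ a k.
      by rewrite /a' expn_gt0; case: ifP => //= _; rewrite leq_exp2l.
    have -> : potential a K' r = potential a' K' r.
      by rewrite /potential !big_nat; apply: eq_bigr => k hk; rewrite /a' hk.
    apply: (IHr K' p a').
      split; [|by move=> k; rewrite /a'; case: ifP|lia].
      by move=> k; have := bl k; have := a'a k; lia.
    move=> u k hu hk; apply: hT; last by lia.
    by move=> k'; have := hu k'; have := a'a k'; lia.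
  have f1 := freeze K (leqnn _) ltac:(lia).
  have f2 := freeze (K + 2 ^ r) (leq_addr _ _) ltac:(lia).
  by rewrite mulSn; lia.
have a_ge e : K <= e < K + 2 ^ r.+1 -> 2 <= a e.
  move=> he; have : 2 * h - a e <= potential a K r.+1.
    rewrite /potential (big_rem e) /=; last by rewrite mem_index_iota.
    exact: leq_addr.
  by lia.
pose x := (coord z i0).-1; pose y := (coord z i1).-1.
pose ex := (x %/ w).*2; pose ey := (y %/ w).*2.+1.
(* [ex] is even and [ey] odd, so the two halvings concern different parts. They raise the potential
   by at most 2, which the query pays for through the term [2 * N]. *)
have [he|p1 [a1 [ok1 sub1 dec1 pot1 oth1]]] := @shrink p a K r.+1 ex x ok _.
  by have := a_ge _ he; lia.
have [he|p2 [a2 [ok2 sub2 dec2 pot2 _]]] := @shrink p1 a1 K r.+1 ey y ok1 _.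
  by rewrite oth1; [have := a_ge _ he; lia|rewrite /ex /ey; lia].
have decx := decided_sub sub2 dec1.
have actK : K <= K < K + 2 ^ r.+1 by have := exp2_gt0 (r.+1); lia.
have lowm := member_low p2 a2.
have := IH (hard p2 K z) N.-1 r.+1 K p2 a2 ok2; move=> IH'.
have : r.+1 * h <= 2 * N.-1 + potential a2 K r.+1.
  apply: IH' => u k hu hk.
  have e := hard_eq ok2 lowm hu actK hk decx dec2.
  have [] := hT u k (sub1 _ (sub2 _ hu)) hk; rewrite /= -e => ? ?; split=> //; lia.
by lia.
Qed.

Lemma query_complexity_lower : h ^ 2 <= query_complexity m.
Proof.
have [[T Ts <-] _] := query_complexityP m_gt0.
(* Initially every active interval fills its block and the potential is 0; with [r = 2 * h] the
   adversary yields [2 * h * h] as a lower bound for twice the number of queries. *)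
pose a k := if k < 2 ^ (2 * h) then 2 * h else 0.
have := @adversary T (worst_case_queries T) (2 * h) 0 (fun k => k./2 * w) a.
have -> : potential a 0 (2 * h) = 0.
  by rewrite /potential big_nat big1 // => k; rewrite add0n /a /= => ->; rewrite subnn.
move=> adv; suff : 2 * h * h <= 2 * worst_case_queries T + 0 by rewrite expnS expn1; lia.
apply: adv; last first.
  move=> u k _ _; split; first exact: Ts.
  apply: leq_trans (leq_bigmax (finfun (hard u k))).
  suff -> : fun_of_fin (finfun (hard u k)) = hard u k by [].
  by apply: funext => z; rewrite ffunE.
split=> // k; last by rewrite add0n /= /a; case: ifP.
by split=> //; rewrite leq_add2l /a; case: ifP.
Qed.
End Adversary.

(** * Bounds in terms of the width, and their asymptotic form *)

Lemma tarski_upper : exists2 C, 0 < C &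
  forall n k, 0 < k -> n < 2 ^ k.+1 -> tarski_query_complexity 3 n <= C * k ^ 2.
Proof.
(* For [l = k.+1 <= 2 * k] the cost [270 * l ^ 2 + 144 * l + 5] is at most [1373 * k ^ 2], within
   the chosen constant. *)
exists 1676 => // n k k_gt0 nk; apply/bigmax_leqP => m /andP[/forallP m_gt0 /eqP wm].
have := @query_complexity_upper _ m_gt0 k.+1; rewrite wm => /(_ (ltnW nk)).
by move=> /leq_trans; apply; rewrite /cube_cost /= expnS expn1; nia.
Qed.

Lemma tarski_lower n h : 0 < h -> 2 ^ (4 * h) <= n -> h ^ 2 <= tarski_query_complexity 3 n.
Proof.
move=> h_gt0 hn; pose m : {ffun 'I_3 -> 'I_n.+1} := [ffun=> ord_max].
have m_eq i : m i = n :> nat by rewrite ffunE.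
have n_gt0 : 0 < n by apply: leq_trans hn; rewrite expn_gt0.
apply: leq_trans (query_complexity_lower m_eq h_gt0 hn) _.
rewrite /tarski_query_complexity.
apply: (@leq_bigmax_cond _ (fun m : {ffun 'I_3 -> 'I_n.+1} =>
   [forall i, 0 < m i] && (width (fun i => m i) == n)) (fun m => query_complexity (fun i => m i)) m).
apply/andP; split; first by apply/forallP => i; rewrite m_eq.
rewrite eqn_leq; apply/andP; split; first by apply/bigmax_leqP => i _; rewrite m_eq.
by apply: leq_trans (leq_bigmax ord0); rewrite m_eq.
Qed.

Import Order.TTheory GRing.Theory Num.Theory.
Local Open Scope classical_set_scope.
Local Open Scope ring_scope.

Theorem theorem15 (R : realType) :
  (fun n : nat => (tarski_query_complexity 3 n)%:R : R^o)
    =Theta_\oo (fun n : nat => ln (n%:R : R) ^+ 2 : R^o).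
Proof.
have [C C0 upper] := tarski_upper.
have {}C0 : 0 < C%:R :> R by rewrite ltr0n.
have l2 : 0 < ln (2 : R) by rewrite ln_gt0 // ltr1n.
pose c : R := ln 2.
rewrite eqThetaE; apply/asboolP.
(* Let [k] be the integer part of the binary logarithm of [n], so that [ln n] lies between [c * k]
   and [c * (k + 1)]. The lower bound is used with [h = k %/ 4]; as [k + 1 <= 8 * h], the factor 64
   is the square of 8. Starting at [n = 16] ensures [k >= 4] and [h > 0]. *)
exists ((64 * c ^+ 2)^-1, C%:R / c ^+ 2) => /=.
  by rewrite invr_gt0 divr_gt0 ?mulr_gt0 ?exprn_gt0.
exists 16%N => // n /= n16.
have [k [k4 kn nk]] : exists k, [/\ (4 <= k)%N, (2 ^ k <= n)%N & (n < 2 ^ k.+1)%N].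
  exists (trunc_log 2 n); split.
  - by apply: trunc_log_max.
  - by apply: trunc_logP => //; apply: leq_trans n16.
  - exact: trunc_log_ltn.
have n0 : (0 < n)%N by apply: leq_trans n16.
have lnX j : ln ((2 ^ j)%N%:R : R) = c *+ j by rewrite natrX lnXn.
have ln_lo : c * k%:R <= ln (n%:R : R).
  by rewrite mulr_natr -lnX ler_ln ?posrE ?ltr0n ?expn_gt0 // ler_nat.
have ln_hi : ln (n%:R : R) <= c * k.+1%:R.
  by rewrite mulr_natr -lnX ler_ln ?posrE ?ltr0n ?expn_gt0 // ler_nat ltnW.
have c0 : 0 < c by [].
have ln0 : 0 <= ln (n%:R : R) by apply: le_trans ln_lo; rewrite mulr_ge0 // ltW.
have [h0 h4 kh] : [/\ (0 < k %/ 4)%N, (4 * (k %/ 4) <= k)%N & (k.+1 <= 8 * (k %/ 4))%N].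
  by split; lia.
have up := upper n k ltac:(lia) nk.
have low : ((k %/ 4) ^ 2 <= tarski_query_complexity 3 n)%N.
  by apply: tarski_lower => //; apply: leq_trans kn; rewrite leq_exp2l.
set T := tarski_query_complexity 3 n in up low *.
rewrite !ger0_norm ?exprn_ge0 ?ler0n //; split.
  rewrite ler_pdivrMl ?mulr_gt0 ?exprn_gt0 //.
  apply: (@le_trans _ _ (64 * c ^+ 2 * (k %/ 4)%N%:R ^+ 2)); last first.
    by rewrite ler_pM2l ?mulr_gt0 ?exprn_gt0 // -natrX ler_nat.
  have -> : 64 * c ^+ 2 * (k %/ 4)%N%:R ^+ 2 = (c * (8 * (k %/ 4)%N%:R)) ^+ 2 by ring.
  rewrite lerXn2r ?nnegrE //; first by rewrite !mulr_ge0 // ltW.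
  apply: le_trans ln_hi _; rewrite ler_pM2l // -natrM ler_nat.
  exact: kh.
rewrite mulrAC ler_pdivlMr ?exprn_gt0 //.
apply: (@le_trans _ _ ((C * k ^ 2)%N%:R * c ^+ 2)).
  by rewrite ler_pM2r ?exprn_gt0 // ler_nat.
have -> : (C * k ^ 2)%N%:R * c ^+ 2 = C%:R * (c * k%:R) ^+ 2 by rewrite natrM natrX; ring.
by rewrite ler_pM2l // lerXn2r ?nnegrE // mulr_ge0 // ltW.
Qed.
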